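(* Let $k$ be a field of characteristic zero, $n\ge 3$, and let $H=(u(x,y),u_2(x,y,x_3),u_3(x,y,x_4),\ldots,u_{n-1}(x,y,x_n),u_n(x,y))$ be a polynomial map over $k$ in the variables $x=x_1,\ y=x_2,\ x_3,\ldots,x_n$. Assume $(u_2)_{x_3}\neq 0$ and $u_y\neq 0$. Let $3\le r\le n$ be the integer such that $(u_i)_{x_{i+1}}\ne 0$ for all $2\le i\le r-1$ and $(u_r)_{x_{r+1}}=0$, and let $d_i=\deg_{x_{i+1}}u_i$ (so $d_i\geq 1$ for $2\le i\le r-1$). Then the Jacobian matrix $JH$ is nilpotent if and only if the following conditions hold. (a) $$u(x,y)=p(y+a(x))\quad\text{and}\quad u_2=-a'(x)u+P_2\Big(x_3+\tfrac{1}{d_2\lambda_2}b_2(x)\Big)$$ for some $p(T)\in k[T]$ with $\deg_T p(T)\ge 1$, $a(x),b_2(x)\in k[x]$ and $P_2(T)\in k[T]$ nice of degree $d_2$ with leading coefficient $\lambda_2$. If $d_2\ge 2$, then $a''(x)=0$. (b) If $3\le i\le r-1$ and $u_{i-1}=\sum_{j=1}^{l}c_{i-1,j}(x)u^j+P_{i-1}\big(x_i+\tfrac{1}{d_{i-1}\lambda_{i-1}}b_{i-1}(x)\big)$ with $c_{i-1,j}(x),b_{i-1}(x)\in k[x]$ and $P_{i-1}(T)\in k[T]$ nice of degree $d_{i-1}$ with leading coefficient $\lambda_{i-1}$, then $$u_i=-\frac{1}{d_{i-1}\lambda_{i-1}}\Big[\sum_{j=1}^{l}\frac{1}{j+1}c_{i-1,j}'(x)u^{j+1}+b_{i-1}'(x)u\Big]+P_i\Big(x_{i+1}+\frac{1}{d_i\lambda_i}b_i(x)\Big)$$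 for some $b_i(x)\in k[x]$ and $P_i(T)\in k[T]$ nice of degree $d_i$ with leading coefficient $\lambda_i$. If $d_{i-1}\ge 2$, then $c_{i-1,j}'(x)=0$ for all $j$. (c) If $u_{r-1}=\sum_{j=1}^{l}c_{r-1,j}(x)u^j+P_{r-1}\big(x_r+\tfrac{1}{d_{r-1}\lambda_{r-1}}b_{r-1}(x)\big)$ with $c_{r-1,j}(x),b_{r-1}(x)\in k[x]$ and $P_{r-1}(T)\in k[T]$ nice of degree $d_{r-1}$ with leading coefficient $\lambda_{r-1}$, then $$u_r(x,y)=-\frac{1}{d_{r-1}\lambda_{r-1}}\Big[\sum_{j=1}^{l}\frac{1}{j+1}c_{r-1,j}'(x)u^{j+1}+b_{r-1}'(x)u\Big]+b_r$$ with $c_{r-1,j}'\in k$ for all $j\ge 1$, $b_r\in k$ and $b_{r-1}'\in k$. If $d_{r-1}\ge 2$, then $c_{r-1,j}'=0$ for all $j$. (d) There are no extra conditions on $u_i$ for $i>r$.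
   Context: Subscripts $x,y,x_i$ denote partial derivatives; a prime denotes the derivative with respect to $x$. By convention $(u_n)_{x_{n+1}}=0$, since $u_n=u_n(x,y)$; hence, as $(u_2)_{x_3}\ne0$, the integer $r$ exists. A polynomial $P(T)\in k[T]$ of degree $d\ge 1$ is called nice if the coefficient of $T^{d-1}$ in $P$ is zero. *)

(* Defs.v *)
From HB Require Import structures.
From mathcomp Require Import all_boot all_order all_algebra.
From mathcomp Require Import mpoly.

Set Implicit Arguments.
Unset Strict Implicit.
Unset Printing Implicit Defensive.

Import GRing.Theory.

Local Open Scope ring_scope.

(* Variables and components are numbered from 1: x = x_1, y = x_2, x_3, ...,
   x_n. Thus x_i is the indeterminate 'X_j with j.+1 = i, and the index
   n + 1 denotes no variable of {mpoly k[n]}. *)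
Definition var_idx (n i : nat) : option 'I_n := [pick j : 'I_n | j.+1 == i].

Definition xvar (k : fieldType) (n i : nat) : {mpoly k[n]} :=
  if var_idx n i is Some j then 'X_j else 0.

(* When x_i is not a variable the value is 0; this is the convention
   (u_n)_{x_{n+1}} = 0. *)
Definition pderiv (k : fieldType) (n i : nat) (f : {mpoly k[n]}) :
  {mpoly k[n]} :=
  if var_idx n i is Some j then f^`M(j) else 0.

Definition degx (k : fieldType) (n i : nat) (f : {mpoly k[n]}) : nat :=
  if var_idx n i is Some j then \max_(m <- msupp f) m j else 0%N.

(* f lies in the subring generated by k and the x_i with i in s. *)
Definition in_vars (k : fieldType) (n : nat) (s : seq nat)
    (f : {mpoly k[n]}) : Prop :=
  forall (m : 'X_{1..n}) (j : 'I_n), m \in msupp f -> m j != 0%N -> j.+1 \in s.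

(* The Jacobian matrix of the polynomial map (u 1, ..., u n); the values of u
   outside 1..n are irrelevant. *)
Definition jacobian (k : fieldType) (n : nat) (u : nat -> {mpoly k[n]}) :
  'M[{mpoly k[n]}]_n :=
  \matrix_(i < n, j < n) (u i.+1)^`M(j).

Definition nilpotent_mx (A : comNzRingType) (n : nat) (M : 'M[A]_n) : Prop :=
  exists m : nat, M ^+ m = 0.

Definition nice (k : fieldType) (P : {poly k}) : Prop :=
  (1 < size P)%N /\ P`_(size P).-2 = 0.

Definition nice_of_degree (k : fieldType) (d : nat) (P : {poly k}) : Prop :=
  size P = d.+1 /\ nice P.

(* f(x), for f in k[T]. *)
Definition inx (k : fieldType) (n : nat) (f : {poly k}) : {mpoly k[n]} :=
  horner_alg (xvar k n 1) f.
Arguments inx {k} n f.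

(* P(x_{i+1} + b(x) / (d lambda)), where lambda is the leading coefficient of
   P. *)
Definition shifted (k : fieldType) (n i d : nat) (b P : {poly k}) :
  {mpoly k[n]} :=
  horner_alg (xvar k n i.+1 + (d%:R * lead_coef P)^-1 *: inx n b) P.
Arguments shifted {k} n i d b P.

(* Main.v *)
Require Import Defs.
From HB Require Import structures.
From mathcomp Require Import all_boot all_order all_algebra.
From mathcomp Require Import mpoly ring.

Set Implicit Arguments.
Unset Strict Implicit.
Unset Printing Implicit Defensive.

Import GRing.Theory.

Local Open Scope ring_scope.

(** Write x, y for the first two variables, U for the first component, subscripts
    for partial derivatives, s_i for the derivative of u_i in its new variable
    x_{i+1}, and D for the derivation U_x d/dy - U_y d/dx.

    The system. Let M be the Jacobian matrix and e_1, .., e_n the standard basis.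
    From the third column on, M e_{i+1} = s_i e_i, and s_r = 0. So
    the r-th power of the leading r x r block maps e_r to its square applied to
    e_2, times the product of the s_i; a nilpotent r x r matrix has zero r-th
    power, so that M nilpotent gives M^2 e_2 = 0 in the first r coordinates
    ([nilpotent_mx_square]). Conversely this makes M nilpotent, one column after
    another ([square_nilpotent_mx]). Written out, these r equations are
    ([nilpotent_jacobian])
      U_x + (u_2)_y = 0  and  s_i (u_{i+1})_y = D u_i  for 2 <= i <= r.

    The first component. On the field of fractions, use x and U as coordinates in
    the plane, in place of x and y: let A = d/dx at U constant, and B = d/dU at x
    constant. They commute, B y = 1 / U_y, and the system becomes
      B u_2 = A y  and  s_i B u_{i+1} = - A u_i.
    If A and B kill all the s_i, then A^r y is, up to such a factor,
    B^{r-1} A u_r = 0. Otherwise, at the first s_i that they do not kill,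
    differentiating the equation in x_{i+1} yields B A u_i = 0, and A^i y = 0. In
    both cases y is locally nilpotent for A ([chain_loc_nil]). Hence so are all
    polynomials, among which U_y, but also 1 / U_y = B y. A unit that is locally
    nilpotent together with its inverse is killed by the derivation
    ([loc_nil_unit]): A U_y = 0, that is U_x U_yy = U_y U_xy
    ([first_component_wronskian]). So the Wronskian in y of U_x and U_y vanishes,
    U_x = a'(x) U_y with a read off the coefficients of U, and U is a polynomial
    with constant coefficients in y + a(x) ([normal_form]).

    The other components. Suppose u_i = C(x, U) + R(x, x_{i+1}). The derivative of
    the equation in x_{i+1} eliminates u_{i+1}: again the Wronskian of R_x and R_z,
    z = x_{i+1}, vanishes, whence R = P(x_{i+1} + shift) by the same lemma, and C
    does not depend on x unless R has degree one ([wronskian_shape],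
    [dxC_shape]). The equation then says that the derivative in y of u_{i+1} is an
    explicit multiple of U_y ([step_equation]), whose integral in y is the
    formula for u_{i+1}, up to a polynomial free of y. For i = r, D u_r = 0 gives
    the last conditions, because 1, U, U^2, .. are independent over k[x]
    ([evx_inj]). Every step is an equivalence, which gives the converse. *)

(** * Derivations and their extension to fraction fields *)

Definition derivation (A : comNzRingType) (d : A -> A) : Prop :=
  {morph d : x y / x + y} /\ forall x y, d (x * y) = d x * y + x * d y.

Section Derivations.
Variables (A : comNzRingType) (d : A -> A).
Hypothesis d_der : derivation d.

Let dD : {morph d : x y / x + y} := d_der.1.
Let dM x y : d (x * y) = d x * y + x * d y := d_der.2 x y.

Lemma der0 : d 0 = 0.
Proof. by apply: (@addrI _ (d 0)); rewrite -dD !addr0. Qed.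

Lemma derN x : d (- x) = - d x.
Proof. by apply: (@addrI _ (d x)); rewrite -dD !subrr der0. Qed.

Lemma derB x y : d (x - y) = d x - d y.
Proof. by rewrite dD derN. Qed.

Lemma der1 : d 1 = 0.
Proof. by apply: (@addrI _ (d 1)); rewrite addr0 -[in RHS](mulr1 1) dM mulr1 mul1r. Qed.

End Derivations.

Lemma derV (K : fieldType) (d : K -> K) x :
  derivation d -> x != 0 -> d x^-1 = - d x / x ^+ 2.
Proof.
move=> d_der x0; have := der1 d_der.
rewrite -(divff x0) d_der.2 => /eqP; rewrite addrC addr_eq0 => /eqP e.
by apply: (mulfI x0); rewrite e; field.
Qed.

(** The quotient rule respects equality, sums and products of fractions, and the
    commutation of two derivations, for formal reasons: the derivatives of the
    numerators and denominators can be any elements of the field. *)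
Section QuotientRule.
Variables (K : fieldType) (a b da db a' b' da' db' : K).
Hypotheses (b0 : b != 0) (b'0 : b' != 0).

Lemma quotient_rule_eq :
  a * b' = a' * b -> da * b' + a * db' = da' * b + a' * db ->
  (da * b - a * db) / b ^+ 2 = (da' * b' - a' * db') / b' ^+ 2.
Proof.
move=> e e'; have aE : a = a' * b / b' by rewrite -e mulfK.
have -> : da = (da' * b + a' * db - a * db') / b' by rewrite -e' addrK mulfK.
by rewrite aE; field; apply/andP.
Qed.

Lemma quotient_rule_add :
  ((da * b' + a * db' + (da' * b + a' * db)) * (b * b')
     - (a * b' + a' * b) * (db * b' + b * db')) / (b * b') ^+ 2
  = (da * b - a * db) / b ^+ 2 + (da' * b' - a' * db') / b' ^+ 2.
Proof. by field; apply/andP. Qed.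

Lemma quotient_rule_mul :
  ((da * a' + a * da') * (b * b') - a * a' * (db * b' + b * db')) / (b * b') ^+ 2
  = (da * b - a * db) / b ^+ 2 * (a' / b')
    + a / b * ((da' * b' - a' * db') / b' ^+ 2).
Proof. by field; apply/andP. Qed.

Lemma quotient_rule_comm ea eb dea deb :
  ((dea * b + ea * db - (da * eb + a * deb)) * (b * b)
     - (ea * b - a * eb) * (db * b + b * db)) / (b * b) ^+ 2
  = ((dea * b + da * eb - (ea * db + a * deb)) * (b * b)
     - (da * b - a * db) * (eb * b + b * eb)) / (b * b) ^+ 2.
Proof. by field. Qed.

End QuotientRule.

Section FractionDerivation.
Variables (R : idomainType) (d : R -> R).
Hypothesis d_der : derivation d.
Local Notation F := {fraction R}.
Local Notation "x %:F" := (@FracField.tofrac R x).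

Lemma fraction_numden (q : F) :
  q = (\n_(repr q))%:F / (\d_(repr q))%:F.
Proof.
have d0 : (\d_(repr q))%:F != 0 by rewrite tofrac_eq0 denom_ratioP.
apply: (mulIf d0); rewrite divfK //; rewrite -{1}[q]reprK.
unlock FracField.tofrac; rewrite -[LHS]FracField.pi_mul.
apply/eqmodP; rewrite /= FracField.equivfE /FracField.mulf.
by rewrite !numden_Ratio ?mulf_neq0 ?oner_eq0 ?denom_ratioP // !mulr1 mulrC.
Qed.

Lemma fraction_ind (P : F -> Prop) :
  (forall a b, b != 0 -> P (a%:F / b%:F)) -> forall q, P q.
Proof. by move=> IH q; rewrite (fraction_numden q); apply/IH/denom_ratioP. Qed.

(** The quotient rule on a chosen representative; by [quotient_rule_unique] it
    holds for all of them. *)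
Definition frac_der (q : F) : F :=
  ((d \n_(repr q))%:F * (\d_(repr q))%:F - (\n_(repr q))%:F * (d \d_(repr q))%:F)
  / (\d_(repr q))%:F ^+ 2.

(** Differentiate [a * b' = a' * b] and divide by [b * b']. *)
Lemma quotient_rule_unique (a b a' b' : R) : b != 0 -> b' != 0 ->
  a%:F / b%:F = a'%:F / b'%:F ->
  ((d a)%:F * b%:F - a%:F * (d b)%:F) / b%:F ^+ 2
  = ((d a')%:F * b'%:F - a'%:F * (d b')%:F) / b'%:F ^+ 2.
Proof.
move=> b0 b'0; have bF : b%:F != 0 by rewrite tofrac_eq0.
have b'F : b'%:F != 0 by rewrite tofrac_eq0.
move=> ab; have e : a * b' = a' * b.
  by apply/eqP; rewrite -tofrac_eq !tofracM -eqr_div //; apply/eqP.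
apply: quotient_rule_eq => //; first by rewrite -!tofracM e.
by rewrite -!tofracM -!tofracD -!d_der.2 e.
Qed.

Lemma frac_derE (a b : R) : b != 0 ->
  frac_der (a%:F / b%:F) = ((d a)%:F * b%:F - a%:F * (d b)%:F) / b%:F ^+ 2.
Proof.
move=> b0; apply: quotient_rule_unique; rewrite ?denom_ratioP //.
by rewrite -fraction_numden.
Qed.

Lemma frac_der_tofrac a : frac_der a%:F = (d a)%:F.
Proof.
rewrite -[a%:F]divr1 -tofrac1 frac_derE ?oner_eq0 // (der1 d_der).
by rewrite tofrac0 tofrac1 mulr0 subr0 expr1n divr1 mulr1.
Qed.

Lemma frac_derivation : derivation frac_der.
Proof.
split; elim/fraction_ind=> a b b0; elim/fraction_ind=> a' b' b'0;
have bF : b%:F != 0 by [rewrite tofrac_eq0];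
have b'F : b'%:F != 0 by [rewrite tofrac_eq0].
- have -> : a%:F / b%:F + a'%:F / b'%:F = (a * b' + a' * b)%:F / (b * b')%:F.
    by rewrite tofracD !tofracM addf_div.
  rewrite !frac_derE ?mulf_neq0 // d_der.1 !d_der.2 !(tofracD, tofracM).
  exact: quotient_rule_add.
- have -> : a%:F / b%:F * (a'%:F / b'%:F) = (a * a')%:F / (b * b')%:F.
    by rewrite !tofracM mulf_div.
  rewrite !frac_derE ?mulf_neq0 // !d_der.2 !(tofracD, tofracM).
  exact: quotient_rule_mul.
Qed.

End FractionDerivation.

Lemma frac_derC (R : idomainType) (d e : R -> R) :
  derivation d -> derivation e -> (forall a, d (e a) = e (d a)) ->
  forall q, frac_der d (frac_der e q) = frac_der e (frac_der d q).
Proof.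
move=> dd ed de; elim/fraction_ind=> a b b0.
have bF : @FracField.tofrac R b != 0 by rewrite tofrac_eq0.
rewrite !frac_derE // (expr2 (FracField.tofrac b)) -!tofracM -!tofracB.
rewrite !frac_derE ?mulf_neq0 // !(derB dd) !(derB ed) !dd.2 !ed.2 !de.
rewrite !(tofracB, tofracD, tofracM); exact: quotient_rule_comm.
Qed.

(** * Locally nilpotent elements of a derivation *)

Definition locally_nilpotent (A : comNzRingType) (d : A -> A) (f : A) : Prop :=
  exists m, iter m d f = 0.

Section LocallyNilpotent.
Variables (A : idomainType) (d : A -> A).
Hypotheses (char0 : [pchar A] =i pred0) (d_der : derivation d).

Lemma iter_derD m : {morph iter m d : f g / f + g}.
Proof. by move=> f g; elim: m => //= m ->; rewrite d_der.1. Qed.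

Lemma iter_der0 m : iter m d 0 = 0.
Proof. by elim: m => //= m ->; rewrite (der0 d_der). Qed.

Lemma iter_der_eq0 m p f : (m <= p)%N -> iter m d f = 0 -> iter p d f = 0.
Proof.
by move=> /subnK <- fm; rewrite iterD fm iter_der0.
Qed.

(** Leibniz' formula in top degree, where a single term survives. *)
Lemma iter_derM a b f g : iter a.+1 d f = 0 -> iter b.+1 d g = 0 ->
  iter (a + b) d (f * g) = 'C(a + b, a)%:R * (iter a d f * iter b d g).
Proof.
move e: (a + b)%N => m; elim: m a b f g e => [|m IHm] a b f g e fa gb.
  by move: e => /eqP; rewrite addn_eq0 => /andP [/eqP -> /eqP ->]; rewrite bin0 mul1r.
rewrite iterSr d_der.2 iter_derD.
case: a e fa => [|a] e fa.
  have -> : iter m d (d f * g) = 0 by rewrite [d f]fa mul0r iter_der0.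
  case: b e gb => [|b] // [e]; rewrite iterSr => gb.
  by rewrite add0r (IHm 0%N b _ _ e fa gb) !bin0 iterSr.
case: b e gb => [|b] e gb.
  have -> : iter m d (f * d g) = 0 by rewrite [d g]gb mulr0 iter_der0.
  case: e fa => [e]; rewrite iterSr => fa.
  by rewrite addr0 (IHm a 0%N _ _ e fa gb) -e addn0 !binn iterSr.
case: e => e; rewrite (IHm a b.+1) -?iterSr //.
have {}e : (a.+1 + b)%N = m by rewrite -e addnS.
rewrite (IHm a.+1 b) -?iterSr //.
by rewrite binS natrD; ring.
Qed.

Lemma loc_nil_add f g :
  locally_nilpotent d f -> locally_nilpotent d g -> locally_nilpotent d (f + g).
Proof.
move=> [a fa] [b gb]; exists (maxn a b).
rewrite iter_derD (iter_der_eq0 (leq_maxl a b)) //.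
by rewrite (iter_der_eq0 (leq_maxr a b)) // addr0.
Qed.

Lemma loc_nil_mul f g :
  locally_nilpotent d f -> locally_nilpotent d g -> locally_nilpotent d (f * g).
Proof.
move=> [a fa] [b gb]; exists (a + b)%N.
rewrite (iter_derM (iter_der_eq0 (leqnSn a) fa) (iter_der_eq0 (leqnSn b) gb)).
by rewrite fa mul0r mulr0.
Qed.

Lemma loc_nil_exp f m : locally_nilpotent d f -> locally_nilpotent d (f ^+ m).
Proof.
move=> f_nil; elim: m => [|m IHm]; last by rewrite exprS; apply: loc_nil_mul.
by exists 1%N; rewrite /= (der1 d_der).
Qed.

(** The order of nilpotency minus one is additive on products, as the degree
    of polynomials is, because the integral domain has characteristic zero; so
    it vanishes on a unit whose inverse is also locally nilpotent. *)
Lemma loc_nil_unit f g : f * g = 1 ->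
  locally_nilpotent d f -> locally_nilpotent d g -> d f = 0.
Proof.
have order h : h != 0 -> locally_nilpotent d h ->
    exists2 a, iter a.+1 d h = 0 & iter a d h != 0.
  move=> h0 [m]; elim: m => [/= e|m IHm hm]; first by rewrite e eqxx in h0.
  by have [/IHm|nz] := eqVneq (iter m d h) 0; last by exists m.
move=> fg; have: f * g != 0 by rewrite fg oner_eq0.
rewrite mulf_eq0 => /norP [f0 g0].
move=> /(order f f0) [a fa a0] /(order g g0) [b gb b0].
have := iter_derM fa gb; rewrite fg.
case: a fa a0 => [//|a] fa a0.
rewrite addSn iterSr (der1 d_der) iter_der0 => /esym /eqP.
rewrite !mulf_eq0 (negbTE a0) (negbTE b0) !orbF => binF.
have bin_gt0 : (0 < 'C((a + b).+1, a.+1))%N by rewrite bin_gt0 ltnS leq_addr.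
by have [p] := natf0_pchar bin_gt0 binF; rewrite char0.
Qed.

End LocallyNilpotent.

(** * Characteristic zero *)

Lemma natr_neq0 (R : idomainType) (char0 : [pchar R] =i pred0) m :
  (0 < m)%N -> m%:R != 0 :> R.
Proof.
by move=> m0; apply/negP => m_eq0; have [p] := natf0_pchar m0 m_eq0; rewrite char0.
Qed.

Lemma pchar0_poly (R : idomainType) :
  [pchar R] =i pred0 -> [pchar {poly R}] =i pred0.
Proof.
by move=> char0 p; rewrite !inE -polyC_natr polyC_eq0 -[RHS](char0 p) !inE.
Qed.

Lemma pchar0_mpoly (k : fieldType) n :
  [pchar k] =i pred0 -> [pchar {mpoly k[n]}] =i pred0.
Proof.
by move=> char0 p; rewrite !inE -mpolyC_nat mpolyC_eq0 -[RHS](char0 p) !inE.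
Qed.

Lemma pchar0_fraction (R : idomainType) :
  [pchar R] =i pred0 -> [pchar {fraction R}] =i pred0.
Proof.
move=> char0 p; rewrite !inE -(rmorph_nat (@FracField.tofrac R)) tofrac_eq0.
by rewrite -[RHS](char0 p) !inE.
Qed.

Lemma deriv_eq0 (R : idomainType) (char0 : [pchar R] =i pred0) (q : {poly R}) :
  q^`() = 0 -> q = (q`_0)%:P.
Proof.
move=> q'0; apply/polyP=> -[|i]; rewrite coefC //=.
have /eqP := congr1 (fun p : {poly R} => p`_i) q'0.
rewrite coef_deriv coef0 -mulr_natr mulf_eq0 (negbTE (natr_neq0 _ _)) // orbF.
by move=> /eqP.
Qed.

(** * Partial derivatives of multivariate polynomials *)

Section PartialDerivatives.
Variables (k : fieldType) (n : nat).
Implicit Types (f : {mpoly k[n]}) (j : 'I_n).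

Lemma var_idxE j : var_idx n j.+1 = Some j.
Proof.
rewrite /var_idx; case: pickP => [i|/(_ j)]; last by rewrite eqxx.
by rewrite eqSS => /eqP/val_inj ->.
Qed.

Lemma var_idx_out i : (n < i)%N -> var_idx n i = None.
Proof.
move=> ni; rewrite /var_idx; case: pickP => // j /eqP ji.
by move: ni; rewrite -ji ltnS leqNgt ltn_ord.
Qed.

Lemma xvarE j : xvar k n j.+1 = 'X_j.
Proof. by rewrite /xvar var_idxE. Qed.

Lemma pderivE j f : pderiv j.+1 f = f^`M(j).
Proof. by rewrite /pderiv var_idxE. Qed.

Lemma degxE j f : degx j.+1 f = \max_(m <- msupp f) m j.
Proof. by rewrite /degx var_idxE. Qed.

Lemma mderiv_derivation j : derivation (mderiv j : {mpoly k[n]} -> {mpoly k[n]}).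
Proof. by split=> f g; rewrite ?mderivD ?mderivM. Qed.

Lemma mderivXU i j : ('X_i : {mpoly k[n]})^`M(j) = (i == j)%:R.
Proof.
rewrite mderivX mnm1E; have [->|_] := eqVneq; last by rewrite scale0r.
by rewrite -[X in (X - _)%MM]add0m addmK mpolyX0 scale1r.
Qed.

Lemma in_vars_mderiv s f j : in_vars s f -> j.+1 \notin s -> f^`M(j) = 0.
Proof.
move=> fs js; rewrite /mderiv big_seq big1 // => m mf.
have [->|mj0] := eqVneq (m j) 0%N; first by rewrite mul0r scale0r.
by case/negP: js; apply: fs mf mj0.
Qed.

Hypothesis char0 : [pchar k] =i pred0.

Lemma mderiv_eq0_msupp f j m : f^`M(j) = 0 -> m \in msupp f -> m j = 0%N.
Proof.
move=> f'0 mf; apply/eqP/negPn/negP => mj0.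
have /eqP := congr1 (fun g => g@_(m - U_(j))) f'0.
rewrite mcoeff_mderiv mcoeff0 submK; last first.
  by apply/mnm_lepP => i; rewrite mnm1E; case: eqVneq => // <-; rewrite lt0n.
rewrite -mulr_natr mulf_eq0 (negbTE (natr_neq0 _ _)) // orbF.
by rewrite mcoeff_eq0 mf.
Qed.

(** In characteristic zero, iterated derivatives detect the degree. *)
Lemma degx_geq f j p : (0 < p)%N -> (p <= degx j.+1 f)%N = (f^`M(j, p) != 0).
Proof.
move=> p0; rewrite degxE; apply/idP/idP => [pd|].
- have [m mf pm] : exists2 m, m \in msupp f & (p <= m j)%N.
    apply/hasP; apply/negPn/negP => /hasPn no; move: pd; rewrite leqNgt.
    case/negP; rewrite big_seq -(prednK p0) ltnS.
    by apply/bigmax_leqP_seq => m /no; rewrite -ltnNge -{1}(prednK p0) ltnS.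
  apply/eqP => /(congr1 (fun g => g@_(m - U_(j) *+ p))) /eqP.
  have pmj : (U_(j) *+ p <= m)%MM.
    apply/mnm_lepP => i; rewrite mulmnE mnm1E.
    by case: eqVneq => [<-|_]; rewrite ?mul1n ?mul0n.
  rewrite mcoeff_mderivm mcoeff0 addmC submK //.
  rewrite -mulr_natr mulf_eq0 mcoeff_eq0 mf (negbTE (natr_neq0 _ _)) //.
  apply: prodn_gt0 => i; rewrite ffact_gt0 mulmnE mnm1E.
  by case: eqVneq => [<-|_]; rewrite ?mul1n ?mul0n.
- apply: contraNT; rewrite -ltnNge => dp.
  rewrite mderivnE big_seq big1 // => m mf.
  rewrite ffact_small ?mul0r ?scale0r //; apply: leq_ltn_trans dp.
  exact: (@leq_bigmax_seq _ _ _ (fun m : 'X_{1..n} => m j)).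
Qed.

End PartialDerivatives.

(** * Polynomials in x and one more element *)

Section Evaluation.
Variables (k : fieldType) (n : nat).

HB.instance Definition _ :=
  GRing.RMorphism.copy (@inx k n) (horner_alg (xvar k n 1)).

(** All the components have the form [evx v q]: [v] is y or a new variable for the
    part to be put in normal form, and the first component for the other one. *)
Definition evx (v : {mpoly k[n]}) (q : {poly {poly k}}) : {mpoly k[n]} :=
  (map_poly (@inx k n) q).[v].

HB.instance Definition _ v :=
  GRing.RMorphism.copy (evx v) (horner_eval v \o map_poly (@inx k n)).

Lemma evxC v c : evx v c%:P = inx n c.
Proof. by rewrite /evx map_polyC hornerC. Qed.

Lemma evxX v : evx v 'X = v.
Proof. by rewrite /evx map_polyX hornerX. Qed.

Lemma evxB v p q : evx v (p - q) = evx v p - evx v q.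
Proof. by apply: (addIr (evx v q)); rewrite -rmorphD !subrK. Qed.

Definition dx (q : {poly {poly k}}) : {poly {poly k}} := map_poly (@deriv k) q.

Lemma coef_dx q i : (dx q)`_i = (q`_i)^`().
Proof. by rewrite coef_map_id0 ?deriv0. Qed.

Lemma dx_derivation : derivation dx.
Proof.
split=> p q; apply/polyP => i; first by rewrite !(coefD, coef_dx) derivD.
rewrite coefD coef_dx !coefM -big_split raddf_sum; apply: eq_bigr => j _ /=.
by rewrite derivM !coef_dx.
Qed.

Lemma dxC c : dx c%:P = (c^`())%:P.
Proof. by rewrite /dx map_polyC. Qed.

Lemma dxX : dx 'X = 0.
Proof.
apply/polyP => i; rewrite coef_dx coefX coef0.
by case: eqP; rewrite ?deriv0 // -polyC1 derivC.
Qed.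

Lemma dx_deriv q : (dx q)^`() = dx q^`().
Proof. by apply/polyP => i; rewrite !(coef_deriv, coef_dx) derivMn. Qed.

Lemma map_polyC_MXaddC (P : {poly k}) c :
  map_poly polyC (P * 'X + c%:P) = map_poly polyC P * 'X + c%:P%:P.
Proof. by rewrite rmorphD rmorphM /= map_polyX map_polyC. Qed.

Lemma dx_comp (P Q : {poly {poly k}}) :
  dx (P \Po Q) = dx P \Po Q + (P^`() \Po Q) * dx Q.
Proof.
elim/poly_ind: P => [|P c IHP].
  by rewrite deriv0 !comp_poly0 (der0 dx_derivation) comp_poly0 mul0r addr0.
rewrite derivMXaddC dx_derivation.1 dx_derivation.2 dxX mulr0 addr0 dxC.
rewrite !comp_poly_MXaddC comp_polyD comp_polyM comp_polyX.
by rewrite dx_derivation.1 dx_derivation.2 IHP dxC; ring.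
Qed.

Lemma dx_polyC (P : {poly k}) : dx (map_poly polyC P) = 0.
Proof. by apply/polyP => i; rewrite coef_dx coef_map coef0 derivC. Qed.

(** [P] has constant coefficients, so that x only occurs in the shift. *)
Lemma dx_polyC_comp (P a : {poly k}) :
  dx (map_poly polyC P \Po ('X + a%:P))
  = (map_poly polyC P \Po ('X + a%:P))^`() * a^`()%:P.
Proof.
rewrite dx_comp dx_polyC comp_poly0 add0r deriv_comp.
by rewrite dx_derivation.1 dxX dxC add0r derivD derivX derivC addr0 mulr1.
Qed.

Lemma evx_comp v (P : {poly k}) (a : {poly k}) :
  evx v (map_poly polyC P \Po ('X + a%:P)) = horner_alg (v + inx n a) P.
Proof.
elim/poly_ind: P => [|P c IHP]; first by rewrite map_poly0 comp_poly0 !rmorph0.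
rewrite map_polyC_MXaddC comp_poly_MXaddC !rmorphD !rmorphM /=.
rewrite IHP rmorphD /= !evxC evxX horner_algX horner_algC; congr (_ + _).
exact: horner_algC.
Qed.

Variables (ix : 'I_n).
Hypothesis (ix0 : ix = 0%N :> nat).

Lemma inxE (c : {poly k}) : inx n c = horner_alg 'X_ix c.
Proof. by rewrite /inx -ix0 xvarE. Qed.

Lemma inxX : inx n 'X = 'X_ix :> {mpoly k[n]}.
Proof. by rewrite inxE horner_algX. Qed.

Lemma inxC (c : k) : inx n c%:P = c%:MP.
Proof. by rewrite inxE horner_algC -mul_mpolyC mulr1. Qed.

Lemma inxZ (c : k) (p : {poly k}) : inx n (c *: p) = c *: inx n p.
Proof. by rewrite -mul_polyC rmorphM /= inxC mul_mpolyC. Qed.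

Lemma inx_mderiv j (c : {poly k}) : (inx n c)^`M(j) = (ix == j)%:R * inx n c^`().
Proof.
elim/poly_ind: c => [|c a IHc]; first by rewrite deriv0 !rmorph0 mderiv0 mulr0.
rewrite derivMXaddC !rmorphD !rmorphM /= inxX inxC mderivD mderivM mderivC IHc.
by rewrite mderivXU; ring.
Qed.

(** The chain rule; the indicator of x accounts for the coefficients of [q]. *)
Lemma evx_mderiv j v q :
  (evx v q)^`M(j) = (ix == j)%:R * evx v (dx q) + evx v q^`() * v^`M(j).
Proof.
elim/poly_ind: q => [|q c IHq].
  by rewrite deriv0 (der0 dx_derivation) !rmorph0 mderiv0 mulr0 mul0r addr0.
rewrite derivMXaddC dx_derivation.1 dx_derivation.2 dxX mulr0 addr0 dxC.
rewrite !rmorphD !rmorphM /= !evxX !evxC mderivD mderivM IHq inx_mderiv.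
by ring.
Qed.

Lemma evx_mderivx v q : (evx v q)^`M(ix) = evx v (dx q) + evx v q^`() * v^`M(ix).
Proof. by rewrite evx_mderiv eqxx mul1r. Qed.

Lemma evx_mderivN j v q : j != ix -> (evx v q)^`M(j) = evx v q^`() * v^`M(j).
Proof. by rewrite eq_sym evx_mderiv => /negbTE ->; rewrite mul0r add0r. Qed.

Lemma inx_mderivx (c : {poly k}) : (inx n c)^`M(ix) = inx n c^`().
Proof. by rewrite inx_mderiv eqxx mul1r. Qed.

Lemma inx_mderivN j (c : {poly k}) : j != ix -> (inx n c)^`M(j) = 0.
Proof. by rewrite eq_sym inx_mderiv => /negbTE ->; rewrite mul0r. Qed.

Lemma evx_mderivn j v q p : j != ix -> v^`M(j) = 1 ->
  (evx v q)^`M(j, p) = evx v q^`(p).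
Proof.
move=> jx v1; elim: p => [|p IHp]; first by rewrite mderivn0.
by rewrite mderivnS IHp evx_mderivN // v1 mulr1 derivnS.
Qed.

Hypothesis char0 : [pchar k] =i pred0.

Lemma inx_inj : injective (@inx k n).
Proof.
suff inx0 (c : {poly k}) : inx n c = 0 -> c = 0 by apply: raddf_inj.
elim: {c}(size c) {-2}c (leqnn (size c)) => [|s IHs] c sc.
  by move: sc; rewrite leqn0 size_poly_eq0 => /eqP.
move=> c0; have := inx_mderivx c; rewrite c0 mderiv0 => /esym /IHs c'0.
have /(deriv_eq0 char0) cE : c^`() = 0.
  apply: c'0; have [->|nz] := eqVneq c 0; first by rewrite deriv0 size_poly0.
  by rewrite -ltnS (leq_trans (lt_size_deriv nz)).
by move: c0; rewrite cE inxC => /eqP; rewrite mpolyC_eq0 => /eqP ->; rewrite polyC0.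
Qed.

(** An element of k[x_1, .., x_n] that depends on another variable than x is
    transcendental over k[x]: differentiate an algebraic relation. *)
Lemma evx_inj j v : j != ix -> v^`M(j) != 0 -> injective (evx v).
Proof.
move=> jx vj; suff evx0 q : evx v q = 0 -> q = 0 by apply: raddf_inj.
elim: {q}(size q) {-2}q (leqnn (size q)) => [|s IHs] q sq.
  by move: sq; rewrite leqn0 size_poly_eq0 => /eqP.
move=> q0; have := evx_mderivN v q jx; rewrite q0 mderiv0.
move=> /esym/eqP; rewrite mulf_eq0 (negbTE vj) orbF => /eqP /IHs q'0.
have /(deriv_eq0 (pchar0_poly char0)) qE : q^`() = 0.
  apply: q'0; have [->|nz] := eqVneq q 0; first by rewrite deriv0 size_poly0.
  by rewrite -ltnS (leq_trans (lt_size_deriv nz)).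
by move: q0; rewrite qE evxC -(rmorph0 (@inx k n)) => /inx_inj ->; rewrite polyC0.
Qed.

Lemma evx_of_mderiv f j : j != ix ->
  (forall i, i != ix -> i != j -> f^`M(i) = 0) -> exists q, f = evx 'X_j q.
Proof.
move=> jx f'0.
exists (\sum_(m <- msupp f) (f@_m *: 'X^(m ix))%:P * 'X^(m j)).
rewrite rmorph_sum {1}[f]mpolyE !big_seq; apply: eq_bigr => m mf.
rewrite rmorphM rmorphXn /= evxC evxX inxZ rmorphXn /= inxX -scalerAl.
congr (_ *: _); rewrite mpolyXE_id (bigD1 ix) //= (bigD1 j) //= big1 ?mulr1 //.
by move=> i /andP [ii ij]; rewrite (mderiv_eq0_msupp char0 (f'0 i ii ij) mf).
Qed.

Lemma inx_of_mderiv (f : {mpoly k[n]}) :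
  (forall i, i != ix -> f^`M(i) = 0) -> exists c, f = inx n c.
Proof.
move=> f'0; exists (\sum_(m <- msupp f) (f@_m *: 'X^(m ix))).
rewrite rmorph_sum {1}[f]mpolyE !big_seq; apply: eq_bigr => m mf.
rewrite /= inxZ rmorphXn /= inxX.
congr (_ *: _); rewrite mpolyXE_id (bigD1 ix) //= big1 ?mulr1 //.
by move=> i ii; rewrite (mderiv_eq0_msupp char0 (f'0 i ii) mf).
Qed.

End Evaluation.

(** * Shifts of polynomials with constant coefficients *)

Section Wronskian.
Variable (R : idomainType).
Hypothesis char0 : [pchar R] =i pred0.

Lemma size_deriv0 (q : {poly R}) : size q^`() = (size q).-1.
Proof.
apply/eqP; rewrite eqn_leq; apply/andP; split.
  have [->|/lt_size_deriv lt_q] := eqVneq q 0; first by rewrite deriv0 size_poly0.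
  by rewrite -ltnS (leq_trans lt_q) // leqSpred.
case e: (size q) => [|[|s]] //=.
rewrite ltnNge; apply/negP => /leq_sizeP /(_ s (leqnn _)) /eqP.
rewrite coef_deriv -mulr_natr mulf_eq0 (negbTE (natr_neq0 _ _)) // orbF.
by rewrite -[s.+1]/(s.+2.-1) -e -/(lead_coef q) lead_coef_eq0 -size_poly_eq0 e.
Qed.

Lemma size_derivn0 (q : {poly R}) p : size q^`(p) = (size q - p)%N.
Proof.
elim: p => [|p IHp]; first by rewrite derivn0 subn0.
by rewrite derivnS size_deriv0 IHp subnS.
Qed.

Lemma lead_coef_deriv (q : {poly R}) :
  lead_coef q^`() = lead_coef q *+ (size q).-1.
Proof.
rewrite lead_coefE size_deriv0 coef_deriv; case e: (size q) => [|[|s]] /=.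
- by move/eqP: e; rewrite size_poly_eq0 => /eqP ->; rewrite coef0 lead_coef0 mul0rn.
- by rewrite mulr0n mulr1n nth_default ?e.
- by rewrite lead_coefE e.
Qed.

(** A vanishing Wronskian forces proportionality, with a factor that is read
    off in degree [(size g).-1]: otherwise the combination [h] of [f] and [g]
    that cancels this coefficient has another degree than [g], and the leading
    coefficients of [h^`() * g] and [h * g^`()] differ by that of the degrees. *)
Lemma wronskian0 (f g : {poly R}) : g != 0 -> f^`() * g = f * g^`() ->
  lead_coef g *: f = f`_(size g).-1 *: g.
Proof.
move=> g0 fg; apply/eqP; rewrite -subr_eq0; set h := _ - _; apply/negPn/negP => h0.
have hg : h^`() * g = h * g^`().
  by rewrite /h derivB !derivZ !mulrBl -!scalerAl fg [g^`() * g]mulrC.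
have /eqP := congr1 lead_coef hg; rewrite !lead_coefM !lead_coef_deriv.
rewrite mulrnAl mulrnAr -[X in X == _]mulr_natr -[X in _ == X]mulr_natr.
rewrite -subr_eq0 -mulrBr !mulf_eq0 !lead_coef_eq0 (negbTE h0) (negbTE g0) /= => degE.
have {}degE : (size h).-1 = (size g).-1.
  apply/eqP/negPn/negP; rewrite neq_ltn => /orP [] lt_deg; move: degE.
  - rewrite -opprB oppr_eq0 -natrB ?(ltnW lt_deg) //.
    by rewrite (negbTE (natr_neq0 _ _)) // subn_gt0.
  - by rewrite -natrB ?(ltnW lt_deg) // (negbTE (natr_neq0 _ _)) // subn_gt0.
move: h0; rewrite -lead_coef_eq0 lead_coefE degE /h coefB !coefZ -lead_coefE.
by rewrite mulrC subrr eqxx.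
Qed.

Lemma derivn_shift (q : {poly R}) a m :
  (q \Po ('X + a%:P))^`(m) = q^`(m) \Po ('X + a%:P).
Proof.
elim: m => [|m IHm]; first by rewrite !derivn0.
by rewrite !derivnS IHm deriv_comp derivD derivX derivC addr0 mulr1.
Qed.

(** A shift moves the coefficient below the leading one by a multiple of the
    latter: compare the derivatives of order [m], which have degree one. *)
Lemma coef_shift (q : {poly R}) a m : size q = m.+2 ->
  (q \Po ('X + a%:P))`_m = q`_m + q`_m.+1 * a *+ m.+1.
Proof.
move=> sq; apply: (mulIf (natr_neq0 char0 (fact_gt0 m))).
have /(congr1 (fun p : {poly R} => p`_0)) := derivn_shift q a m.
rewrite coef_derivn addn0 ffactnn mulr_natr => ->.
have -> : q^`(m) = (q`_m *+ m`!)%:P + (q`_m.+1 *+ (m.+1)`!) *: 'X.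
  apply/polyP => i; rewrite coef_derivn coefD coefC coefZ coefX.
  case: i => [|[|i]] /=.
  - by rewrite mulr0 addr0 addn0 ffactnn.
  - by rewrite add0r mulr1 addn1 -(ffact_fact (leqnSn m)) subSnn muln1.
  - by rewrite mulr0 addr0 nth_default ?mul0rn // sq !addnS !ltnS leq_addr.
rewrite comp_polyD comp_polyC comp_polyZ comp_polyX.
rewrite coefD coefC coefZ coefD coefX coefC /=.
by rewrite add0r factS mulrDl !mulr_natr -mulrnA mulrnAl.
Qed.

End Wronskian.

Section NormalForm.
Variable (k : fieldType).
Hypothesis char0 : [pchar k] =i pred0.

(** By [wronskian0], [dx R] is [a^`()] times the derivative of [R], where [a] is
    the quotient of the coefficient [b] of degree [d.-1] by [d * lam]; the leading
    coefficient [lam] is constant because [dx R] has degree less than [d]. So the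
    shift of [R] by [- a] has constant coefficients, and [coef_shift] shows that
    it is nice. *)
Lemma normal_form (R : {poly {poly k}}) (d := (size R).-1) :
  (1 < size R)%N -> dx R^`() * R^`() = dx R * R^`()^`() ->
  exists b P : {poly k}, nice_of_degree d P /\
    R = map_poly polyC P \Po ('X + ((d%:R * lead_coef P)^-1 *: b)%:P).
Proof.
move=> sR; rewrite -dx_deriv.
have char0' := pchar0_poly char0.
have sR' : size R^`() = d by rewrite size_deriv0.
have d0 : (0 < d)%N by rewrite /d; case: size sR => [|[]].
have sRd : size R = d.+1 by rewrite /d; case: size sR.
have R'0 : R^`() != 0 by rewrite -size_poly_gt0 sR'.
move=> /(wronskian0 char0' R'0); rewrite lead_coef_deriv // sR' coef_dx -/d.
set b := R`_d.-1 => e.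
have lRd : R`_d = lead_coef R by rewrite lead_coefE.
have := congr1 (fun q : {poly {poly k}} => q`_d) e.
rewrite !coefZ coef_dx coef_deriv [R`_d.+1]nth_default ?sRd // mul0rn mulr0 lRd => /eqP.
have lR0 : lead_coef R != 0 by rewrite lead_coef_eq0 -size_poly_gt0 sRd.
have Q0 : lead_coef R *+ d != 0.
  by rewrite -[_ *+ d]mulr_natr mulf_neq0 // (natr_neq0 char0').
rewrite mulf_eq0 (negbTE Q0) /=.
move=> /eqP /(deriv_eq0 char0); set lam := (lead_coef R)`_0 => lamE.
have lam0 : lam != 0 by apply: contraNneq lR0 => l0; rewrite lamE l0.
have dlam0 : d%:R * lam != 0 by rewrite mulf_neq0 // (natr_neq0 char0).
set a := (d%:R * lam)^-1 *: b.
have dxR : dx R = a^`()%:P * R^`().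
  have Qp : (lead_coef R *+ d)%:P != 0 by rewrite polyC_eq0.
  apply: (mulfI Qp); rewrite [LHS]mul_polyC e -mul_polyC mulrA -polyCM.
  congr (_%:P * _); rewrite lamE /a derivZ -mul_polyC mulrA -[_ *+ d]mulr_natl.
  rewrite -polyC_natr -!polyCM.
  by rewrite divff // mul1r.
pose S := R \Po ('X - a%:P).
have S_const : dx S = 0.
  rewrite dx_comp dxR comp_polyM comp_polyC (derB (dx_derivation k)) dxX dxC.
  by rewrite add0r mulrN mulrC subrr.
have sS : size S = d.+1 by rewrite size_comp_poly2 ?size_XsubC.
pose P := map_poly (fun c : {poly k} => c`_0) S.
have SE : S = map_poly polyC P.
  apply/polyP => i; rewrite !coef_map_id0 ?coef0 //.
  by apply: (deriv_eq0 char0); rewrite -coef_dx S_const coef0.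
have sP : size P = d.+1 by rewrite -sS SE size_map_polyC.
have RE : R = S \Po ('X + a%:P).
  by have := comp_polyXaddC_K R (- a); rewrite polyCN opprK.
have lP : lead_coef P = lam.
  have : lead_coef S = lead_coef R.
    by rewrite lead_coef_comp ?size_XsubC // lead_coefXsubC expr1n mulr1.
  rewrite SE lead_coef_map_inj //; last exact: polyC_inj.
  by rewrite lamE => /polyC_inj.
exists b, P; rewrite lP -/a -SE; split=> //; split=> //; split; first by rewrite sP.
rewrite sP /=; apply: polyC_inj.
have -> : (P`_d.-1)%:P = S`_d.-1 by rewrite SE coef_map.
rewrite /S -polyCN (coef_shift char0') prednK // ?sRd // -/b lRd lamE.
rewrite mulrN mulNrn -[_ *+ d]mulr_natl -polyC_natr mulrA -polyCM mul_polyC.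
by rewrite /a scalerA divff // scale1r subrr.
Qed.

End NormalForm.

(** * Chains of equations between two commuting derivations *)

Section Chain.
Variables (K : comNzRingType) (d e : K -> K).
Hypotheses (d_der : derivation d) (e_der : derivation e).
Hypothesis de : forall f, d (e f) = e (d f).

Lemma iter_derC m f : d (iter m e f) = iter m e (d f).
Proof. by elim: m => //= m <-; rewrite de. Qed.

Lemma iter_der_const m c f : e c = 0 -> iter m e (c * f) = c * iter m e f.
Proof. by move=> c0; elim: m => //= m ->; rewrite e_der.2 c0 mul0r add0r. Qed.

(** By induction on [i], the [i.-1]-th iterate of [e] at [G i], multiplied by a
    constant of both derivations, is the [i.-1]-th iterate of [d] at [y]. This goes
    on as long as [s i] is itself such a constant. It stops with the
    nilpotency of [y] as soon as [e] kills [d (G i)], which happens at [i = r] if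
    not before. *)
Lemma chain_loc_nil y (G s : nat -> K) r : (2 <= r)%N ->
  e (G 2) = d y ->
  (forall i, (2 <= i < r)%N -> s i * e (G i.+1) = - d (G i)) ->
  (forall i, (2 <= i < r)%N -> (d (s i) = 0 /\ e (s i) = 0) \/ e (d (G i)) = 0) ->
  d (G r) = 0 -> locally_nilpotent d y.
Proof.
move=> r2 start step alt stop.
have finish i c : (2 <= i)%N -> d c = 0 -> e (d (G i)) = 0 ->
    c * iter i.-1 e (G i) = iter i.-1 d y -> locally_nilpotent d y.
  case: i => [|[|i]] // _ dc edG E; exists i.+2; rewrite iterS -E /= d_der.2 dc.
  have -> : d (e (iter i e (G i.+2))) = 0.
    rewrite -iterS iter_derC iterSr edG; elim: (i) => //= m ->.
    exact: der0 e_der.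
  by rewrite mul0r mulr0 addr0.
have loop m : (m.+2 <= r)%N -> locally_nilpotent d y \/
    exists c, [/\ d c = 0, e c = 0 & c * iter m.+1 e (G m.+2) = iter m.+1 d y].
  elim: m => [|m IHm] mr.
    by right; exists 1; rewrite !der1 // mul1r /= start.
  have mr' : (2 <= m.+2 < r)%N by [].
  have [|[c [dc ec E]]] := IHm (ltnW mr); first by left.
  have [[ds es]|edG] := alt _ mr'; last by left; apply: (finish m.+2 c).
  right; exists (- (c * s m.+2)); split.
  - by rewrite derN // d_der.2 dc ds mul0r mulr0 addr0 oppr0.
  - by rewrite derN // e_der.2 ec es mul0r mulr0 addr0 oppr0.
  rewrite [RHS]iterS -E d_der.2 dc mul0r add0r iter_derC.
  rewrite iterSr mulNr -mulrA -(iter_der_const _ _ es) step // -mulrN.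
  congr (_ * _); move: (d (G _)) => z.
  by elim: m.+1 => [|j IHj]; rewrite ?opprK //= -IHj (derN e_der).
have r1E : r.-2.+1 = r.-1 by case: (r) r2 => [|[]].
have rE : r.-2.+2 = r by case: (r) r2 => [|[]].
have := loop r.-2; rewrite rE r1E => /(_ (leqnn r)) [//|[c [dc ec E]]].
by apply: (finish r c); rewrite // stop der0.
Qed.

End Chain.

(** * Level curves of the first component *)

Section LevelCoordinates.
Variables (F : fieldType) (Dx Dy : F -> F) (u : F).
Hypotheses (DxP : derivation Dx) (DyP : derivation Dy).
Hypothesis DxDy : forall q, Dx (Dy q) = Dy (Dx q).
Hypothesis uy0 : Dy u != 0.

(** The partial derivatives in the coordinates x and [u], in place of x and y. *)
Definition along_level (q : F) : F := Dx q - Dx u / Dy u * Dy q.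
Definition across_level (q : F) : F := (Dy u)^-1 * Dy q.

Lemma along_levelE q :
  along_level q = - (Dx u * Dy q - Dy u * Dx q) / Dy u.
Proof. by rewrite /along_level; field. Qed.

Lemma along_level_derivation : derivation along_level.
Proof.
split=> p q; rewrite /along_level ?DxP.1 ?DyP.1 ?DxP.2 ?DyP.2; last by ring.
by rewrite mulrDr opprD addrACA.
Qed.

Lemma across_level_derivation : derivation across_level.
Proof.
split=> p q; rewrite /across_level ?DyP.1 ?DyP.2; last by ring.
by rewrite mulrDr.
Qed.

Lemma along_acrossC q : along_level (across_level q) = across_level (along_level q).
Proof.
rewrite /along_level /across_level (derB DyP) !DxP.2 !DyP.2 !(derV DxP) ?(derV DyP) //.
by rewrite !DxDy; field.
Qed.

End LevelCoordinates.

Section FirstComponent.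
Variables (k : fieldType) (n : nat).
Hypothesis char0 : [pchar k] =i pred0.
Local Notation A := {mpoly k[n]}.
Local Notation F := {fraction A}.
Local Notation "f %:F" := (@FracField.tofrac A f).

Lemma mpoly_loc_nil (d : F -> F) : derivation d ->
  (forall c : k, d (c%:MP)%:F = 0) ->
  (forall j : 'I_n, locally_nilpotent d ('X_j)%:F) ->
  forall f : A, locally_nilpotent d f%:F.
Proof.
move=> dP dC dX; elim/mpolyind => [|c m p _ _ IHp].
  by exists 0%N; rewrite /= tofrac0.
rewrite tofracD; apply: loc_nil_add => //.
rewrite -mul_mpolyC tofracM; apply: loc_nil_mul => //; first by exists 1%N; apply: dC.
rewrite mpolyXE_id rmorph_prod; apply: (big_ind (locally_nilpotent d)).
- by exists 1%N; apply: der1.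
- by move=> p1 q1; apply: loc_nil_mul => //=.
- by move=> j _; rewrite rmorphXn; apply: loc_nil_exp => //=.
Qed.

Variables (ix iy : 'I_n) (u : A).
Hypotheses (iyx : iy != ix) (u_y : u^`M(iy) != 0).

Local Notation Dx := (frac_der (mderiv ix : A -> A)).
Local Notation Dy := (frac_der (mderiv iy : A -> A)).
Let DxP : derivation Dx := frac_derivation (mderiv_derivation k ix).
Let DyP : derivation Dy := frac_derivation (mderiv_derivation k iy).
Let DxE (f : A) : Dx f%:F = (f^`M(ix))%:F := frac_der_tofrac (mderiv_derivation k ix) f.
Let DyE (f : A) : Dy f%:F = (f^`M(iy))%:F := frac_der_tofrac (mderiv_derivation k iy) f.
Local Notation along := (along_level Dx Dy u%:F).
Local Notation across := (across_level Dy u%:F).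
Let uy0 : Dy u%:F != 0. Proof. by rewrite DyE tofrac_eq0. Qed.

Lemma DxDy (q : F) : Dx (Dy q) = Dy (Dx q).
Proof.
by apply: frac_derC => [||f]; [exact: mderiv_derivation.. | exact: mderiv_comm].
Qed.

Lemma along_eq0 f : along f%:F = 0 ->
  u^`M(ix) * f^`M(iy) = u^`M(iy) * f^`M(ix).
Proof.
rewrite /along_level => /eqP; rewrite subr_eq0 => /eqP e.
apply/eqP; rewrite -tofrac_eq !tofracM -!DxE -!DyE e; apply/eqP.
by rewrite [RHS]mulrA (mulrC (Dy _) (_ / _)) divfK.
Qed.

(** The polynomial [u^`M(iy)] is locally nilpotent along the level curves of [u]
    because y is; so is its inverse, which is the derivative of y across these
    curves. Apply [loc_nil_unit]. *)
Lemma loc_nil_wronskian : locally_nilpotent along ('X_iy)%:F ->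
  u^`M(ix) * u^`M(iy)^`M(iy) = u^`M(iy) * u^`M(iy)^`M(ix).
Proof.
move=> y_nil; apply: along_eq0.
have alongP := along_level_derivation u%:F DxP DyP.
have acrossP := across_level_derivation u%:F DyP.
have along0 (f : A) : f^`M(ix) = 0 -> f^`M(iy) = 0 -> along f%:F = 0.
  by move=> fx fy; rewrite /along_level !DxE !DyE fx fy tofrac0 mulr0 subr0.
have iter_across m q : iter m along (across q) = across (iter m along q).
  by elim: m => //= m ->; rewrite along_acrossC //; apply: DxDy.
have charF : [pchar F] =i pred0 by apply/pchar0_fraction/pchar0_mpoly.
have uyF : (u^`M(iy))%:F != 0 by rewrite tofrac_eq0.
apply: (loc_nil_unit charF alongP (g := across ('X_iy)%:F)).
- by rewrite /across_level !DyE mderivXU eqxx tofrac1 mulr1 (mulfV uyF).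
- apply: mpoly_loc_nil => // [c|j]; first by apply: along0; rewrite mderivC.
  have [-> //|jy] := eqVneq j iy.
  exists 2 => /=; rewrite {2}/along_level !DxE !DyE !mderivXU (negbTE jy).
  rewrite tofrac0 mulr0 subr0.
  by case: (j == ix); rewrite ?tofrac1 ?tofrac0 ?(der1 alongP) ?(der0 alongP).
- have [m ym] := y_nil; exists m; rewrite iter_across ym (der0 acrossP) //.
Qed.

(** Here [z i] is the new variable of [g i]. If [s i], the derivative of [g i] in
    it, still depends on [z i], the equation differentiated in [z i] expresses the
    derivative of [g i.+1] across the level curves of [u] by derivatives of [s i],
    which are constant across them; so the second derivative vanishes, hence by
    the equation the derivative of [g i] along the curves is constant across
    them. If [s i] does not depend on [z i], the same equation shows that it does
    not depend on x. *)
Lemma first_component_wronskian (g : nat -> A) (z : nat -> 'I_n) r :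
  (2 <= r)%N ->
  u^`M(ix) + (g 2)^`M(iy) = 0 ->
  (forall i, (2 <= i < r)%N -> u^`M(z i) = 0 /\ (g i.+1)^`M(z i) = 0) ->
  (forall i, (2 <= i < r)%N -> (g i)^`M(z i)^`M(iy) = 0) ->
  (forall i, (2 <= i < r)%N -> (g i)^`M(z i) * (g i.+1)^`M(iy)
     = u^`M(ix) * (g i)^`M(iy) - u^`M(iy) * (g i)^`M(ix)) ->
  u^`M(ix) * (g r)^`M(iy) - u^`M(iy) * (g r)^`M(ix) = 0 ->
  u^`M(ix) * u^`M(iy)^`M(iy) = u^`M(iy) * u^`M(iy)^`M(ix).
Proof.
move=> r2 start zfree s_y step stop; apply: loc_nil_wronskian.
have uyF : (u^`M(iy))%:F != 0 by rewrite tofrac_eq0.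
have alongP := along_level_derivation u%:F DxP DyP.
have acrossP := across_level_derivation u%:F DyP.
have comm := along_acrossC DxP DyP DxDy uy0.
have alongE f : along f%:F =
    - (u^`M(ix) * f^`M(iy) - u^`M(iy) * f^`M(ix))%:F / (u^`M(iy))%:F.
  by rewrite (along_levelE _ uy0) !DxE !DyE tofracB !tofracM.
pose s i := (g i)^`M(z i).
have stepF i : (2 <= i < r)%N ->
    (s i)%:F * across (g i.+1)%:F = - along (g i)%:F.
  move=> ir; rewrite alongE mulNr opprK -step // tofracM /across_level !DyE.
  by rewrite mulrCA mulrC.
apply: (chain_loc_nil alongP acrossP comm (G := fun i => (g i)%:F)
  (s := fun i => (s i)%:F) r2).
- rewrite alongE /across_level !DyE !mderivXU eqxx (negbTE iyx) mulr1 mulr0 subr0.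
  move/eqP: start; rewrite addrC addr_eq0 => /eqP ->.
  by rewrite tofracN mulrC.
- exact: stepF.
- move=> i ir; have [uz gz] := zfree i ir.
  have sz : (s i)^`M(z i) * (g i.+1)^`M(iy) = - (u^`M(iy) * (s i)^`M(ix)).
    have := congr1 (mderiv (z i)) (step i ir); rewrite mderivB !mderivM -/(s i).
    have -> : (g i.+1)^`M(iy)^`M(z i) = 0 by rewrite mderiv_comm gz mderiv0.
    have -> : u^`M(ix)^`M(z i) = 0 by rewrite mderiv_comm uz mderiv0.
    have -> : u^`M(iy)^`M(z i) = 0 by rewrite mderiv_comm uz mderiv0.
    have -> : (g i)^`M(iy)^`M(z i) = 0 by rewrite mderiv_comm s_y.
    have -> : (g i)^`M(ix)^`M(z i) = (s i)^`M(ix) by rewrite mderiv_comm.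
    by rewrite !mulr0 !mul0r !addr0 !add0r.
  have across_s : across (s i)%:F = 0.
    by rewrite /across_level !DyE s_y // tofrac0 mulr0.
  have [sz0|sz0] := eqVneq (s i)^`M(z i) 0; [left|right].
  + split=> //; rewrite /along_level !DxE !DyE [(s i)^`M(iy)]s_y // tofrac0 mulr0 subr0.
    move: sz; rewrite sz0 mul0r => /esym/eqP; rewrite oppr_eq0 mulf_eq0 (negbTE u_y) /=.
    by move=> /eqP ->; rewrite tofrac0.
  + have szF : ((s i)^`M(z i))%:F != 0 by rewrite tofrac_eq0.
    have e : ((s i)^`M(z i))%:F * across (g i.+1)%:F = - ((s i)^`M(ix))%:F.
      apply: (mulfI uyF); rewrite /across_level !DyE mulrCA (mulVKf uyF) -tofracM sz.
      by rewrite tofracN tofracM mulrN.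
    have across0 (j : 'I_n) : across ((s i)^`M(j))%:F = 0.
      rewrite /across_level !DyE mderiv_comm [(s i)^`M(iy)]s_y //.
      by rewrite mderiv0 tofrac0 mulr0.
    have := congr1 across e; rewrite acrossP.2 (derN acrossP) !across0 mul0r add0r oppr0.
    move/eqP; rewrite mulf_eq0 (negbTE szF) /= => /eqP e2.
    have := congr1 across (stepF i ir); rewrite acrossP.2 across_s e2 mul0r mulr0 addr0.
    by rewrite (derN acrossP) => /esym/eqP; rewrite oppr_eq0 => /eqP.
- by rewrite alongE stop tofrac0 oppr0 mul0r.
Qed.

End FirstComponent.

(** * Nilpotency of a matrix with a superdiagonal beyond its second column *)

(** The minimal polynomial over the field of fractions divides a power of the
    indeterminate, and its degree is at most [r]. *)
Lemma nilpotent_mx_exp (A : idomainType) r (N : 'M[A]_r) : nilpotent_mx N -> N ^+ r = 0.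
Proof.
case: r N => [|r] N [m Nm]; first by apply/matrixP => -[].
pose f : {rmorphism A -> {fraction A}} := @FracField.tofrac A; pose Nf := map_mx f N.
have Xm : mxminpoly Nf %| ('X - 0%:P) ^+ m.
  apply: mxminpoly_min; rewrite subr0 rmorphXn /= horner_mx_X.
  by rewrite /Nf -rmorphXn /= Nm map_mx0.
have [j jm /eqpP [[a b] /= /andP [a0 b0] e]] := dvdp_exp_XsubCP Xm.
have jr : (j <= r.+1)%N.
  have := dvdp_leq (monic_neq0 (char_poly_monic Nf)) (mxminpoly_dvd_char Nf).
  rewrite size_char_poly -(size_scale _ a0) e size_scale // subr0 size_polyXn.
  by rewrite ltnS.
have Nfj : Nf ^+ j = 0.
  have := congr1 (horner_mx Nf) e; rewrite !linearZ /= mx_root_minpoly scaler0.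
  rewrite subr0 rmorphXn /= horner_mx_X => /esym/eqP.
  by rewrite scaler_eq0 (negbTE b0) => /eqP.
have Nfr : map_mx f (N ^+ r.+1) = 0.
  rewrite rmorphXn /= -/Nf.
  have -> : Nf ^+ r.+1 = Nf ^+ (r.+1 - j) * Nf ^+ j by rewrite -exprD subnK.
  by rewrite Nfj mulr0.
apply/matrixP => i1 i2; move/matrixP: Nfr => /(_ i1 i2) /eqP.
by rewrite !mxE tofrac_eq0 => /eqP.
Qed.

Section Criterion.
Variables (A : idomainType) (n r : nat) (M : 'M[A]_n).
Variables (i0 i1 : 'I_n).
Hypotheses (i0E : i0 = 0%N :> nat) (i1E : i1 = 1%N :> nat).
Hypotheses (r3 : (3 <= r)%N) (rn : (r <= n)%N).
Hypothesis M_shape : forall i j : 'I_n, (2 <= j)%N -> i.+1 != j :> nat -> M i j = 0.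
Hypothesis M_stop : forall i j : 'I_n, j = r :> nat -> M i j = 0.
Hypothesis M_super : forall i j : 'I_n, (2 <= j < r)%N -> i.+1 = j -> M i j != 0.
Hypothesis M01 : M i0 i1 != 0.

Lemma mx_expSr m i j : (M ^+ m.+1) i j = \sum_l (M ^+ m) i l * M l j.
Proof. by rewrite exprSr mxE. Qed.

Lemma mx_exp_col m i (p j : 'I_n) : (2 <= j)%N -> p.+1 = j ->
  (M ^+ m.+1) i j = (M ^+ m) i p * M p j.
Proof.
move=> j2 pj; rewrite mx_expSr (bigD1 p) //= big1 ?addr0 // => l lp.
by rewrite M_shape ?mulr0 // -pj eqSS.
Qed.

Lemma M_block (i j : 'I_n) : (i < r <= j)%N -> M i j = 0.
Proof.
move=> /andP [ir rj]; have [jr|jr] := eqVneq (nat_of_ord j) r; first exact: M_stop.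
rewrite M_shape ?(leq_trans _ rj) ?(ltnW r3) //.
by apply: contraNneq jr => ij; rewrite eqn_leq rj -ij ir.
Qed.

Lemma mx_exp_block m (i j : 'I_n) : (i < r <= j)%N -> (M ^+ m) i j = 0.
Proof.
elim: m i => [|m IHm] i ij.
  rewrite expr0 mxE; case: eqP ij => // ->.
  by rewrite ltnNge; case: (r <= j)%N.
rewrite exprS mxE big1 // => l _; have [lr|rl] := ltnP l r.
  by rewrite IHm ?mulr0 // lr; case/andP: ij.
by rewrite M_block ?mul0r // rl andbT; case/andP: ij.
Qed.

Lemma mx_exp_lead m : let w := widen_ord rn in
  (mxsub w w M) ^+ m = mxsub w w (M ^+ m).
Proof.
move=> w; elim: m => [|m IHm].
  by apply/matrixP => i j; rewrite !mxE.
apply/matrixP => i j; rewrite exprSr IHm mxE [RHS]mxE mx_expSr.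
rewrite [RHS](bigID (fun l : 'I_n => l < r)%N) /= [X in _ + X]big1 ?addr0; last first.
  by move=> l; rewrite -leqNgt => rl; rewrite mx_exp_block ?mul0r //= ltn_ord.
by rewrite (big_ord_narrow rn); apply: eq_bigr => l _; rewrite !mxE.
Qed.

(** On the leading block, the [r]-th power of [M] vanishes; its last column there
    is the second column of the square of [M], times a product of superdiagonal
    entries. *)
Lemma nilpotent_mx_square : nilpotent_mx M ->
  forall i : 'I_n, (i < r)%N -> (M ^+ 2) i i1 = 0.
Proof.
move=> [m Mm] i ir.
have Mr (j : 'I_n) : (j < r)%N -> (M ^+ r) i j = 0.
  move=> jr; have : (mxsub (widen_ord rn) (widen_ord rn) M) ^+ r = 0.
    apply: nilpotent_mx_exp; exists m; rewrite mx_exp_lead Mm.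
    by apply/matrixP => a b; rewrite !mxE.
  rewrite mx_exp_lead => /matrixP /(_ (Ordinal ir) (Ordinal jr)); rewrite !mxE.
  have -> : widen_ord rn (Ordinal ir) = i by apply: val_inj.
  by have -> : widen_ord rn (Ordinal jr) = j by apply: val_inj.
suff up t (j : 'I_n) : j = t.+1 :> nat -> (j < r)%N -> (M ^+ t.+2) i j = 0 ->
    (M ^+ 2) i i1 = 0.
  have r1 : (r.-1 < n)%N by rewrite prednK ?(leq_trans _ r3).
  have r2E : r.-2.+2 = r by case: (r) r3 => [|[]].
  apply: (up r.-2 (Ordinal r1)); rewrite /= ?r2E ?Mr //=.
  - by case: (r) r3 => [|[]].
  - by rewrite -{2}r2E ltnS; case: (r) r3 => [|[]].
  - by rewrite -{2}r2E ltnS; case: (r) r3 => [|[]].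
elim: t j => [|t IHt] j jE jr.
  by have -> : j = i1 by apply: val_inj; rewrite /= jE i1E.
have pn : (t.+1 < n)%N by rewrite (leq_trans _ rn) // -jE ltnW.
have j2 : (2 <= j)%N by rewrite jE.
rewrite (@mx_exp_col _ _ (Ordinal pn)) // => /eqP; rewrite mulf_eq0.
rewrite (negbTE (M_super _ _)) ?jr ?j2 ?orbF //= => /eqP.
by apply: IHt => //=; rewrite -jE ltnW.
Qed.

(** The columns from the [r]-th one on die along the superdiagonal; then the
    second one does, because its image under [M ^+ 2] lies in their span; then
    those between, and the first one since [M i0 i1] is not zero. *)
Lemma square_nilpotent_mx :
  (forall i : 'I_n, (i < r)%N -> (M ^+ 2) i i1 = 0) -> nilpotent_mx M.
Proof.
move=> M2; have persist a b (j : 'I_n) :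
    (forall i, (M ^+ a) i j = 0) -> (a <= b)%N -> forall i, (M ^+ b) i j = 0.
  move=> col /subnK <- i; rewrite exprD mxE big1 // => l _.
  by rewrite col mulr0.
have tail m (j : 'I_n) : j = (r + m)%N :> nat -> forall i, (M ^+ m.+1) i j = 0.
  elim: m j => [|m IHm] j jE i.
    by rewrite expr1 M_stop // jE addn0.
  have pn : (r + m < n)%N by rewrite (leq_trans _ (ltn_ord j)) // jE addnS ltnW.
  rewrite (@mx_exp_col _ _ (Ordinal pn)) /= ?jE ?addnS //.
    by rewrite (IHm (Ordinal pn)) ?mul0r.
  by rewrite ltnS (leq_trans _ (leq_addr _ _)) // (leq_trans _ r3).
have {}tail (j : 'I_n) : (r <= j)%N -> forall i, (M ^+ n) i j = 0.
  move=> rj; apply: (persist (j - r).+1).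
    by apply: tail; rewrite subnKC.
  rewrite (leq_ltn_trans (leq_subr _ _)) //.
have col1 i : (M ^+ (n + 2)) i i1 = 0.
  rewrite exprD mxE big1 // => l _; have [lr|rl] := ltnP l r.
    by rewrite M2 ?mulr0.
  by rewrite tail ?mul0r.
have cols m (j : 'I_n) : j = m.+1 :> nat -> forall i, (M ^+ (n + 2 + m)) i j = 0.
  elim: m j => [|m IHm] j jE i.
    by have -> : j = i1 by [apply: val_inj; rewrite /= jE i1E]; rewrite addn0.
  have pn : (m.+1 < n)%N by rewrite (leq_trans _ (ltn_ord j)) // jE ltnW.
  rewrite addnS (@mx_exp_col _ _ (Ordinal pn)) /= ?jE //.
  by rewrite (IHm (Ordinal pn)) ?mul0r.
have {}cols (j : 'I_n) : j != i0 -> forall i, (M ^+ (n + 2 + n)) i j = 0.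
  move=> j0; have j1 : (0 < j)%N.
    by rewrite lt0n; apply: contraNneq j0 => j0; apply/eqP/val_inj; rewrite /= j0 i0E.
  apply: (persist (n + 2 + j.-1)%N); first by apply: cols; rewrite prednK.
  by rewrite leq_add2l -ltnS prednK // ltnW ?ltnS ?ltn_ord // ltnW.
have i10 : i1 != i0 by apply/eqP => e; move: i1E; rewrite e i0E.
exists (n + 2 + n)%N; apply/matrixP => i j; rewrite [RHS]mxE.
have [->|] := eqVneq j i0; last by move/cols.
have := persist _ _ _ (cols i1 i10) (leqnSn _) i.
rewrite mx_expSr (bigD1 i0) //= big1 ?addr0 => [/eqP|l l0].
  by rewrite mulf_eq0 (negbTE M01) orbF => /eqP.
by rewrite cols ?mul0r.
Qed.

End Criterion.

(** * The part of a component that is polynomial in the first one *)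

Section PolynomialPart.
Variables (k : fieldType) (n : nat).
Hypothesis char0 : [pchar k] =i pred0.

Definition poly_part l (c : nat -> {poly k}) : {poly {poly k}} :=
  \sum_(1 <= j < l.+1) (c j)%:P * 'X^j.

(** By [deriv_next_part], this is the antiderivative without constant term of
    [- kappa] times the sum of [dx (poly_part l c)] and of the derivative of [b]. *)
Definition next_part (kappa : k) l (c : nat -> {poly k}) (b : {poly k}) :
    {poly {poly k}} :=
  (- kappa)%:P%:P *
    ('X * poly_part l (fun j => j.+1%:R^-1 *: (c j)^`()) + b^`()%:P * 'X).

Lemma coef_poly_part l c i :
  (poly_part l c)`_i = if (1 <= i <= l)%N then c i else 0.
Proof.
rewrite /poly_part; elim: l => [|l IHl].
  by rewrite big_geq // coef0; case: i.
rewrite big_nat_recr //= coefD IHl coefCM coefXn.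
have [->|il] := eqVneq i l.+1; first by rewrite ltnn /= leqnn mulr1 add0r.
by rewrite mulr0 addr0 [(i <= l.+1)%N]leq_eqVlt (negbTE il).
Qed.

Lemma coef_next_part kappa l c b i : (next_part kappa l c b)`_i =
  if i is j.+1 then
    - kappa *: (if (1 <= j <= l)%N then j.+1%:R^-1 *: (c j)^`()
                else if j == 0%N then b^`() else 0)
  else 0.
Proof.
rewrite /next_part coefCM coefD coefXM coefMX coef_poly_part coefC.
case: i => [|j] /=; first by rewrite addr0 mulr0.
by rewrite mul_polyC; case: j => [|j] /=; rewrite ?add0r ?addr0.
Qed.

Lemma dx_poly_part l c : dx (poly_part l c) = poly_part l (fun j => (c j)^`()).
Proof.
by apply/polyP => i; rewrite coef_dx !coef_poly_part; case: ifP; rewrite ?deriv0.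
Qed.

Lemma deriv_next_part kappa l c b : (next_part kappa l c b)^`() =
  (- kappa)%:P%:P * (dx (poly_part l c) + b^`()%:P).
Proof.
apply/polyP => i; rewrite coef_deriv coef_next_part coefCM coefD coefC.
rewrite dx_poly_part coef_poly_part mul_polyC scalerMnr; congr (_ *: _).
case: ifP => [/andP [i0 _]|_].
  rewrite -scaler_nat scalerA divff ?natr_neq0 // scale1r.
  by case: (i) i0 => //= ? _; rewrite addr0.
by case: (i) => [|j] /=; rewrite ?add0r ?mulr1n ?mul0rn.
Qed.

Lemma evx_poly_part (v : {mpoly k[n]}) l c :
  evx v (poly_part l c) = \sum_(1 <= j < l.+1) inx n (c j) * v ^+ j.
Proof.
rewrite rmorph_sum; apply: eq_bigr => j _.
by rewrite rmorphM rmorphXn /= evxC evxX.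
Qed.

Variable (ix : 'I_n).
Hypothesis (ix0 : ix = 0%N :> nat).

Lemma evx_next_part (v : {mpoly k[n]}) kappa l c b :
  evx v (next_part kappa l c b) =
  - kappa *: (\sum_(1 <= j < l.+1) j.+1%:R^-1 *: (inx n (c j)^`() * v ^+ j.+1)
              + inx n b^`() * v).
Proof.
rewrite rmorphM /= evxC (inxC ix0) mul_mpolyC rmorphD !rmorphM /= evxC !evxX.
congr (_ *: (_ + _)); rewrite evx_poly_part big_distrr; apply: eq_bigr => j _ /=.
by rewrite (inxZ ix0) exprS -!scalerAl -scalerAr mulrCA.
Qed.

(** * One step of the system *)

Variables (iy : 'I_n) (U : {mpoly k[n]}).
Hypotheses (iyx : iy != ix) (U_y : U^`M(iy) != 0).

Lemma nice_degree_gt0 d (P : {poly k}) : nice_of_degree d P -> (0 < d)%N.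
Proof. by case=> sP [P1 _]; rewrite -ltnS -sP. Qed.

Lemma nice_lead_neq0 d (P : {poly k}) :
  nice_of_degree d P -> d%:R * lead_coef P != 0.
Proof.
move=> nP; have d0 := nice_degree_gt0 nP; case: nP => sP _.
by rewrite mulf_neq0 ?natr_neq0 // lead_coef_eq0 -size_poly_gt0 sP.
Qed.

Definition shifted_poly d (b P : {poly k}) : {poly {poly k}} :=
  map_poly polyC P \Po ('X + ((d%:R * lead_coef P)^-1 *: b)%:P).

Lemma size_shifted_poly d b P : size (shifted_poly d b P) = size P.
Proof. by rewrite size_comp_poly2 ?size_XaddC // size_map_polyC. Qed.

Lemma shiftedE (j : 'I_n) d b P : shifted n j d b P = evx 'X_j (shifted_poly d b P).
Proof. by rewrite /shifted xvarE evx_comp (inxZ ix0). Qed.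

Lemma deriv_shifted_poly1 b (P : {poly k}) : size P = 2 ->
  (shifted_poly 1 b P)^`() = (lead_coef P)%:P%:P.
Proof.
move=> sP; have P' : P^`() = (lead_coef P)%:P.
  apply/polyP => -[|i]; rewrite coef_deriv coefC /= ?mulr1n ?lead_coefE ?sP //.
  by rewrite nth_default ?sP // mul0rn.
rewrite /shifted_poly deriv_comp deriv_map P' map_polyC comp_polyC /=.
by rewrite derivD derivX derivC addr0 mulr1.
Qed.

(** Let [s] be the derivative of [f] in [z], [K] be [evx U (dx C)] and [ka] the
    inverse of [d * lead_coef P]. The right-hand side of the equation is minus
    [U_y] times the sum of [K] and [ka * s * b^`()]. Now [K = ka * s * K], since [K]
    is zero when [d >= 2] and [s] is the leading coefficient of [P] when [d = 1].
    So [s] cancels on both sides. *)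
Lemma step_equation (z : 'I_n) d (C : {poly {poly k}}) (b P : {poly k})
    (f w : {mpoly k[n]}) :
  z != ix -> z != iy -> U^`M(z) = 0 ->
  nice_of_degree d P -> ((2 <= d)%N -> dx C = 0) ->
  f = evx U C + shifted n z d b P ->
  f^`M(z) * w = U^`M(ix) * f^`M(iy) - U^`M(iy) * f^`M(ix) <->
  w = - (d%:R * lead_coef P)^-1 *: ((evx U (dx C) + inx n b^`()) * U^`M(iy)).
Proof.
move=> zx zy Uz nP dC; rewrite shiftedE; set S := shifted_poly d b P => ->.
set ka := (_ * _)^-1.
have ka0 : ka != 0 by rewrite invr_eq0 (nice_lead_neq0 nP).
have XyE : ('X_z : {mpoly k[n]})^`M(iy) = 0 by rewrite mderivXU (negbTE zy).
have XxE : ('X_z : {mpoly k[n]})^`M(ix) = 0 by rewrite mderivXU (negbTE zx).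
have XzE : ('X_z : {mpoly k[n]})^`M(z) = 1 by rewrite mderivXU eqxx.
rewrite !mderivD !(evx_mderivx ix0) !(evx_mderivN ix0) // Uz XyE XxE XzE.
rewrite !mulr0 !addr0 add0r mulr1.
have S'0 : S^`() != 0.
  rewrite -size_poly_gt0 (size_deriv0 (pchar0_poly char0)) size_shifted_poly.
  by case: (nP) => -> _; apply: nice_degree_gt0 nP.
have s0 : evx 'X_z S^`() != 0.
  rewrite -(rmorph0 (evx 'X_z)) (inj_eq (evx_inj ix0 char0 zx _)) ?XzE ?oner_eq0 //.
have dxS : evx 'X_z (dx S) = evx 'X_z S^`() * (ka *: inx n b^`()).
  by rewrite dx_polyC_comp rmorphM /= evxC derivZ (inxZ ix0).
have sK : ka *: evx 'X_z S^`() * evx U (dx C) = evx U (dx C).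
  have [d2|] := ltnP 1 d; first by rewrite dC // rmorph0 mulr0.
  move=> d1; have {d1} dE : d = 1%N.
    by apply/eqP; rewrite eqn_leq d1 (nice_degree_gt0 nP).
  have sP : size P = 2 by case: nP => ->; rewrite dE.
  rewrite /S /ka dE deriv_shifted_poly1 // evxC (inxC ix0) -mul_mpolyC -mpolyCM mul1r.
  by rewrite mulVf ?mul1r // -[lead_coef P]mul1r -[1]/(1%:R) -dE (nice_lead_neq0 nP).
set s := evx 'X_z S^`() in s0 dxS sK *; set K := evx U (dx C) in sK *.
have -> : U^`M(ix) * (evx U C^`() * U^`M(iy))
     - U^`M(iy) * (K + evx U C^`() * U^`M(ix) + evx 'X_z (dx S))
  = s * (- ka *: ((K + inx n b^`()) * U^`M(iy))).
  rewrite dxS -{1}sK -!mul_mpolyC mpolyCN; ring.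
by split => [/(mulfI s0)|->].
Qed.

End PolynomialPart.

(** * The shape of a component *)

Section Shape.
Variables (k : fieldType) (n : nat) (ix iy z : 'I_n) (U f w : {mpoly k[n]}).
Variables (C R : {poly {poly k}}).
Hypothesis char0 : [pchar k] =i pred0.
Hypothesis ix0 : ix = 0%N :> nat.
Hypotheses (iyx : iy != ix) (zx : z != ix) (zy : z != iy).
Hypotheses (U_y : U^`M(iy) != 0) (U_z : U^`M(z) = 0).
Hypothesis fE : f = evx U C + evx 'X_z R.
Hypothesis f_z : f^`M(z) != 0.

Let XyE : ('X_z : {mpoly k[n]})^`M(iy) = 0.
Proof. by rewrite mderivXU (negbTE zy). Qed.
Let XxE : ('X_z : {mpoly k[n]})^`M(ix) = 0.
Proof. by rewrite mderivXU (negbTE zx). Qed.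
Let XzE : ('X_z : {mpoly k[n]})^`M(z) = 1.
Proof. by rewrite mderivXU eqxx. Qed.
Let evz_inj : injective (evx ('X_z : {mpoly k[n]})).
Proof. by apply: (evx_inj ix0 char0 zx); rewrite XzE oner_eq0. Qed.
Let evz_eq0 q : (evx ('X_z : {mpoly k[n]}) q == 0) = (q == 0).
Proof. by rewrite -(inj_eq evz_inj) rmorph0. Qed.

Lemma mderiv_shape : f^`M(z) = evx 'X_z R^`().
Proof.
by rewrite fE mderivD !(evx_mderivN ix0) // U_z XzE mulr0 add0r mulr1.
Qed.

Lemma size_shape : (1 < size R)%N.
Proof.
rewrite ltnNge; apply: contraNN f_z => sR; rewrite mderiv_shape evz_eq0 -size_poly_eq0.
by rewrite (size_deriv0 (pchar0_poly char0)); case: size sR => [|[]].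
Qed.

Lemma degx_shape : degx z.+1 f = (size R).-1.
Proof.
have f_zn p : f^`M(z, p.+1) = evx 'X_z R^`(p.+1).
  by rewrite mderivSn mderiv_shape (evx_mderivn ix0) // derivSn.
apply/eqP; rewrite eqn_leq; apply/andP; split.
- rewrite leqNgt (degx_geq char0) // f_zn evz_eq0 negbK -size_poly_eq0.
  by rewrite (size_derivn0 (pchar0_poly char0)) prednK ?subnn // (leq_trans _ size_shape).
- case e: (size R) size_shape => [|[|s]] // _.
  rewrite (degx_geq char0) //= f_zn evz_eq0 -size_poly_eq0.
  by rewrite (size_derivn0 (pchar0_poly char0)) e subSnn.
Qed.

Hypothesis C0 : C`_0 = 0.
Hypothesis w_z : w^`M(z) = 0.
Hypothesis eq_f : f^`M(z) * w = U^`M(ix) * f^`M(iy) - U^`M(iy) * f^`M(ix).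

Let K := evx U (dx C).

Let eqK : f^`M(z) * w = - U^`M(iy) * (K + evx 'X_z (dx R)).
Proof.
rewrite eq_f fE !mderivD !(evx_mderivx ix0) !(evx_mderivN ix0) // XyE XxE /K.
by ring.
Qed.

(** Eliminate [w] between the equation and its derivative in [z]. *)
Let elim_w :
  f^`M(z)^`M(z) * K = evx 'X_z (R^`() * (dx R)^`() - dx R * R^`()^`()).
Proof.
have f_zz : f^`M(z)^`M(z) = evx 'X_z R^`()^`().
  by rewrite mderiv_shape (evx_mderivN ix0) // XzE mulr1.
have U_yz : U^`M(iy)^`M(z) = 0 by rewrite mderiv_comm U_z mderiv0.
have := congr1 (mderiv z) eqK.
rewrite !mderivM w_z mulr0 addr0 mderivN U_yz oppr0 mul0r add0r mderivD.
rewrite /K !(evx_mderivN ix0) // U_z XzE mulr0 add0r mulr1 -/K => e.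
have -> : evx 'X_z (R^`() * (dx R)^`() - dx R * R^`()^`())
    = f^`M(z) * evx 'X_z (dx R)^`() - evx 'X_z (dx R) * f^`M(z)^`M(z).
  by rewrite f_zz mderiv_shape evxB !rmorphM.
have := congr1 ( *%R f^`M(z)^`M(z)) eqK.
rewrite mulrCA e; move: (evx _ (dx R)) (evx _ (dx R)^`()) (K) => a a' K' e2.
apply: (mulfI U_y).
have -> : U^`M(iy) * (f^`M(z) * a' - a * f^`M(z)^`M(z))
  = - (f^`M(z) * (- U^`M(iy) * a')) - U^`M(iy) * a * f^`M(z)^`M(z) by ring.
by rewrite e2; ring.
Qed.

(** The coefficients of the identity [elim_w] are free of y, except for [K]; so
    [K] is free of y when [f] has degree at least two in [z]. Then [dx C] is
    constant in [U], and its constant term is zero. *)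
Lemma dxC_shape : (2 < size R)%N -> dx C = 0.
Proof.
move=> sR; have f_zz0 : f^`M(z)^`M(z) != 0.
  rewrite mderiv_shape (evx_mderivN ix0) // XzE mulr1 evz_eq0 -size_poly_eq0.
  by rewrite !(size_deriv0 (pchar0_poly char0)); case: size sR => [|[|[]]].
have f_zzy : f^`M(z)^`M(z)^`M(iy) = 0.
  by rewrite mderiv_shape (evx_mderivN ix0) // XzE mulr1 (evx_mderivN ix0) // XyE mulr0.
have := congr1 (mderiv iy) elim_w; rewrite mderivM f_zzy mul0r add0r.
rewrite /K !(evx_mderivN ix0) // XyE mulr0 => /eqP.
rewrite !mulf_eq0 (negbTE f_zz0) (negbTE U_y) orbF /= => /eqP evC0.
have dxC'0 : (dx C)^`() = 0.
  by apply: (evx_inj ix0 char0 iyx U_y); rewrite evC0 rmorph0.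
by rewrite (deriv_eq0 (pchar0_poly char0) dxC'0) coef_dx C0 deriv0.
Qed.

(** The left-hand side of [elim_w] is zero, by [dxC_shape] or because [f] has
    degree one in [z]. *)
Lemma wronskian_shape : dx R^`() * R^`() = dx R * R^`()^`().
Proof.
have fz0 : f^`M(z)^`M(z) * K = 0.
  have [sR|] := ltnP 2 (size R); first by rewrite /K dxC_shape // rmorph0 mulr0.
  move=> sR; suff -> : f^`M(z)^`M(z) = 0 by rewrite mul0r.
  rewrite mderiv_shape (evx_mderivN ix0) // XzE mulr1; apply/eqP; rewrite evz_eq0.
  rewrite -size_poly_eq0 !(size_deriv0 (pchar0_poly char0)).
  by case: size sR => [|[|[]]].
move: elim_w; rewrite fz0 => /esym/eqP; rewrite evz_eq0 subr_eq0 => /eqP.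
by rewrite -dx_deriv mulrC.
Qed.

End Shape.

(** * The Jacobian matrix and the system of differential equations *)

Section Map.
Variables (k : fieldType) (n : nat) (u : nat -> {mpoly k[n]}) (r : nat).
Hypothesis char0 : [pchar k] =i pred0.
Hypothesis n_ge3 : (3 <= n)%N.
Hypothesis u1_vars : in_vars [:: 1; 2]%N (u 1%N).
Hypothesis ui_vars : forall i : nat, (2 <= i <= n.-1)%N ->
  in_vars [:: 1; 2; i.+1]%N (u i).
Hypothesis un_vars : in_vars [:: 1; 2]%N (u n).
Hypothesis u_y : pderiv 2 (u 1%N) <> 0.
Hypothesis r_bounds : (3 <= r <= n)%N.
Hypothesis r_below : forall i : nat, (2 <= i <= r.-1)%N -> pderiv i.+1 (u i) <> 0.
Hypothesis r_stop : pderiv r.+1 (u r) = 0.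

Let r3 : (3 <= r)%N. Proof. by case/andP: r_bounds. Qed.
Let rn : (r <= n)%N. Proof. by case/andP: r_bounds. Qed.

Definition ix : 'I_n := Ordinal (ltnW (ltnW n_ge3)).
Definition iy : 'I_n := Ordinal (ltnW n_ge3).
(** The default value is only reached for [n <= i]. *)
Definition iz (i : nat) : 'I_n := insubd ix i.

Local Notation U := (u 1%N).

Let ix0 : ix = 0%N :> nat. Proof. by []. Qed.
Let iyx : iy != ix. Proof. by []. Qed.

Lemma izE i : (i < n)%N -> iz i = i :> nat.
Proof. by move=> i_n; rewrite /iz val_insubd i_n. Qed.

Lemma pderiv_iz i (f : {mpoly k[n]}) : (i < n)%N -> pderiv i.+1 f = f^`M(iz i).
Proof. by move=> /izE e; rewrite -pderivE e. Qed.

Let U_y0 : U^`M(iy) != 0.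
Proof. by apply/eqP => e; apply: u_y; rewrite -[2%N]/(iy.+1) pderivE. Qed.

Lemma U_free (j : 'I_n) : (2 <= j)%N -> U^`M(j) = 0.
Proof.
move=> j2; apply: (in_vars_mderiv u1_vars); rewrite !inE.
by case: (nat_of_ord j) j2 => [|[|]].
Qed.

Lemma u_free i (j : 'I_n) : (2 <= i <= n)%N -> (2 <= j)%N -> j != i :> nat ->
  (u i)^`M(j) = 0.
Proof.
move=> /andP [i2 i_n] j2 ji; have [iE|i_ne] := eqVneq i n.
  rewrite iE; apply: (in_vars_mderiv un_vars); rewrite !inE.
  by case: (nat_of_ord j) j2 => [|[|]].
have ib : (2 <= i <= n.-1)%N.
  by rewrite i2 -ltnS (prednK (ltnW (ltnW n_ge3))) ltn_neqAle i_ne.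
apply: (in_vars_mderiv (ui_vars ib)); rewrite !inE !eqSS (negbTE ji) orbF.
by case: (nat_of_ord j) j2 => [|[|]].
Qed.

Lemma ur_free (j : 'I_n) : (2 <= j)%N -> (u r)^`M(j) = 0.
Proof.
move=> j2; have [jr|jr] := eqVneq (nat_of_ord j) r; first by rewrite -pderivE jr.
by apply: u_free => //; rewrite rn ltnW.
Qed.

Lemma s_neq0 i : (2 <= i < r)%N -> (u i)^`M(iz i) != 0.
Proof.
move=> /andP [i2 ir]; apply/eqP; rewrite -pderiv_iz ?(leq_trans ir) //.
by apply: r_below; rewrite i2 -ltnS (prednK (ltnW (ltnW r3))).
Qed.

Definition jacobian_system : Prop :=
  U^`M(ix) + (u 2)^`M(iy) = 0 /\
  forall i, (2 <= i <= r)%N -> pderiv i.+1 (u i) * (u i.+1)^`M(iy)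
    = U^`M(ix) * (u i)^`M(iy) - U^`M(iy) * (u i)^`M(ix).

Lemma jacobian_shape (i j : 'I_n) : (2 <= j)%N -> i.+1 != j :> nat ->
  jacobian u i j = 0.
Proof.
move=> j2 ij; rewrite mxE; case: (posnP i) => [->|i0]; first exact: U_free.
by apply: u_free; rewrite ?ltn_ord ?ltnS ?i0 // eq_sym.
Qed.

Lemma jacobian_sqr0 :
  (jacobian u ^+ 2) ix iy = U^`M(iy) * (U^`M(ix) + (u 2)^`M(iy)).
Proof.
rewrite expr2 mxE (bigD1 ix) //= (bigD1 iy) //= big1 ?addr0 => [|l].
  by rewrite !mxE /=; ring.
move=> /andP [lx ly]; rewrite mxE U_free ?mul0r //.
by case: l lx ly => -[|[|l]] //=.
Qed.

(** In the last row, the third term is zero by the convention of [pderiv]. *)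
Lemma jacobian_sqr (i : 'I_n) (c := i.+1) : (0 < i)%N ->
  (jacobian u ^+ 2) i iy = (u c)^`M(ix) * U^`M(iy) + (u c)^`M(iy) * (u 2)^`M(iy)
    + pderiv c.+1 (u c) * (u c.+1)^`M(iy).
Proof.
move=> i0; rewrite expr2 mxE (bigD1 ix) //= (bigD1 iy) //= addrA !mxE -/c.
congr (_ + _); have lt1 (l : 'I_n) : l != ix -> l != iy -> (2 <= l)%N.
  by case: l => -[|[|l]].
have [cn|nc] := ltnP c n.
- have zE := izE cn; rewrite (bigD1 (iz c)) /=; last first.
    by apply/andP; split; apply/eqP => e; move: i0; rewrite -ltnS -/c -zE e.
  rewrite !mxE -/c zE pderiv_iz // big1 ?addr0 // => l.
  move=> /andP [/andP [lx ly]] lz; rewrite jacobian_shape ?mul0r //; first exact: lt1.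
  by apply: contraNneq lz => lE; apply/eqP/val_inj; rewrite /= zE -lE.
- rewrite /pderiv var_idx_out ?ltnS // mul0r big1 // => l /andP [lx ly].
  rewrite jacobian_shape ?mul0r //; first exact: lt1.
  by apply: contraTneq (ltn_ord l) => <-; rewrite -leqNgt.
Qed.

Lemma nilpotent_jacobian : nilpotent_mx (jacobian u) <-> jacobian_system.
Proof.
have stop (i j : 'I_n) : j = r :> nat -> jacobian u i j = 0.
  move=> jr; have [ij|ij] := eqVneq i.+1 (nat_of_ord j).
    by rewrite mxE ij jr; apply: ur_free; rewrite jr ltnW.
  by apply: jacobian_shape; rewrite // jr ltnW.
have super (i j : 'I_n) : (2 <= j < r)%N -> i.+1 = j -> jacobian u i j != 0.
  move=> jb ij; rewrite mxE ij; have := s_neq0 jb.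
  by have -> : iz j = j by apply: val_inj; rewrite /= izE.
have c01 : jacobian u ix iy != 0 by rewrite mxE.
have iy1 : iy = 1%N :> nat by [].
have crit := nilpotent_mx_square iy1 r3 rn jacobian_shape stop super.
have crit' := square_nilpotent_mx ix0 iy1 r3 jacobian_shape stop c01.
have sqr_eq (i : 'I_n) : (0 < i)%N -> U^`M(ix) + (u 2)^`M(iy) = 0 ->
    ((jacobian u ^+ 2) i iy = 0 <-> pderiv i.+2 (u i.+1) * (u i.+2)^`M(iy)
    = U^`M(ix) * (u i.+1)^`M(iy) - U^`M(iy) * (u i.+1)^`M(ix)).
  move=> i0 /eqP; rewrite addrC addr_eq0 => /eqP u2y.
  rewrite jacobian_sqr // u2y; split => [/eqP|->]; last by ring.
  rewrite addrC addr_eq0 => /eqP ->; ring.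
split => [/crit sq|[e0 e]].
- have e0 : U^`M(ix) + (u 2)^`M(iy) = 0.
    have /eqP := sq ix (leq_trans (isT : 0 < 3)%N r3).
    by rewrite jacobian_sqr0 mulf_eq0 (negbTE U_y0) => /eqP.
  split=> // -[//|i] /andP [i0 ir]; have i_n := leq_trans ir rn.
  by apply/(sqr_eq (Ordinal i_n) i0 e0)/sq.
- apply: crit' => i ir; case: (posnP i) => [i0|i0].
    have -> : i = ix by apply: val_inj.
    by rewrite jacobian_sqr0 e0 mulr0.
  by apply/(sqr_eq i i0 e0)/e; rewrite ltnS i0.
Qed.

(** * Necessity *)

Variable d : nat -> nat.
Hypothesis d_def : forall i : nat, (2 <= i <= r.-1)%N -> d i = degx i.+1 (u i).

Lemma mderiv_mderiv0 (f : {mpoly k[n]}) i j : f^`M(j) = 0 -> f^`M(i)^`M(j) = 0.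
Proof. by move=> fj; rewrite mderiv_comm fj mderiv0. Qed.

Lemma evxU_free (C : {poly {poly k}}) (j : 'I_n) : (2 <= j)%N -> (evx U C)^`M(j) = 0.
Proof.
move=> j2; rewrite (evx_mderivN ix0) ?U_free ?mulr0 //.
by apply: contraTneq j2 => ->.
Qed.

Lemma iz_facts i : (2 <= i < r)%N ->
  [/\ iz i = i :> nat, iz i != ix, iz i != iy & (2 <= iz i)%N].
Proof.
move=> /andP [i2 ir]; have zE := izE (leq_trans ir rn).
by split; rewrite ?zE //; apply/eqP => e; move: i2; rewrite -zE e.
Qed.

Lemma shifted_iz i m (b P : {poly k}) : (2 <= i < r)%N ->
  shifted n i m b P = evx 'X_(iz i) (shifted_poly m b P).
Proof. by move=> /iz_facts [zE _ _ _]; rewrite -(shiftedE ix0) zE. Qed.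

Lemma pred_r i : (i <= r.-1)%N = (i < r)%N.
Proof. by rewrite -ltnS (prednK (ltnW (ltnW r3))). Qed.

Lemma step_equation_iz i (C : {poly {poly k}}) (b P : {poly k}) : (2 <= i < r)%N ->
  nice_of_degree (d i) P -> ((2 <= d i)%N -> dx C = 0) ->
  u i = evx U C + shifted n i (d i) b P ->
  pderiv i.+1 (u i) * (u i.+1)^`M(iy)
    = U^`M(ix) * (u i)^`M(iy) - U^`M(iy) * (u i)^`M(ix) <->
  (u i.+1)^`M(iy) =
    - ((d i)%:R * lead_coef P)^-1 *: ((evx U (dx C) + inx n b^`()) * U^`M(iy)).
Proof.
move=> ir nP dC uE; have [zE zx zy z2] := iz_facts ir.
have i_n : (i < n)%N by case/andP: ir => _ /leq_trans; apply.
rewrite pderiv_iz //; apply: (step_equation char0 ix0 iyx _ zx zy (U_free z2) nP dC).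
by rewrite zE.
Qed.

Section Necessity.
Hypothesis sys : jacobian_system.

(** The component [u i] depends on its new variable, but not its derivative in y:
    the equation of the previous component gives the product of this derivative by
    a non-zero polynomial free of the new variable; for the second component, it
    is [- U^`M(ix)]. *)
Lemma w_free i (j : 'I_n) : (2 <= i <= r)%N -> (2 <= j)%N ->
  (u i)^`M(iy)^`M(j) = 0.
Proof.
move=> /andP [i2 ir] j2; have i_n := leq_trans ir rn.
have [ji|ji] := eqVneq (nat_of_ord j) i; last first.
  by apply: mderiv_mderiv0; apply: u_free; rewrite // i2.
have [e0 e] := sys; case: i i2 ir i_n ji => [|[|[|i]]] // _ ir i_n ji.
  move/eqP: e0; rewrite addrC addr_eq0 => /eqP ->.
  by rewrite mderivN mderiv_mderiv0 ?oppr0 ?U_free.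
have ir' : (2 <= i.+2 < r)%N by [].
have [_ _ _ z2] := iz_facts ir'.
have uj : (u i.+2)^`M(j) = 0.
  by apply: u_free; rewrite ?ji ?(ltnW i_n) // neq_ltn leqnn orbT.
have := congr1 (mderiv j) (e i.+2 (ltnW ir)).
rewrite pderiv_iz ?(leq_trans _ i_n) // mderivB !mderivM.
rewrite !(mderiv_mderiv0 _ uj) !(mderiv_mderiv0 _ (U_free j2)).
rewrite !mul0r !mulr0 !addr0 add0r subrr => /eqP.
by rewrite mulf_eq0 (negbTE (s_neq0 ir')) => /eqP.
Qed.

Lemma first_component : exists p a : {poly k}, [/\ (1 < size p)%N,
  U = horner_alg (xvar k n 2 + inx n a) p &
  U^`M(ix) = inx n a^`() * U^`M(iy)].
Proof.
have [e0 e] := sys.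
have wr : U^`M(ix) * U^`M(iy)^`M(iy) = U^`M(iy) * U^`M(iy)^`M(ix).
  apply: (@first_component_wronskian k n char0 ix iy U iyx U_y0 u iz r (ltnW r3) e0).
  - move=> i ir; have [zE _ _ z2] := iz_facts ir; split; first exact: U_free.
    case/andP: ir => i2 ir; apply: u_free; rewrite ?zE ?(leq_trans ir rn) ?(leqW i2) //.
    by rewrite neq_ltn leqnn.
  - move=> i ir; have [zE _ _ z2] := iz_facts ir; rewrite mderiv_comm w_free //.
    by case/andP: ir => -> /ltnW ->.
  - move=> i ir; case/andP: (ir) => i2 ri; rewrite -pderiv_iz ?(leq_trans ri) //.
    by apply: e; rewrite i2 ltnW.
  - have rr : (2 <= r <= r)%N by rewrite leqnn andbT ltnW.
    by rewrite -(e r rr) r_stop mul0r.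
have [R UE] : exists R, U = evx 'X_iy R.
  apply: (evx_of_mderiv ix0 char0 iyx) => j jx jy; apply: U_free.
  by case: j jx jy => -[|[|j]].
have yx : ('X_iy : {mpoly k[n]})^`M(ix) = 0 by rewrite mderivXU.
have yy : ('X_iy : {mpoly k[n]})^`M(iy) = 1 by rewrite mderivXU.
have UxE : U^`M(ix) = evx 'X_iy (dx R).
  by rewrite UE (evx_mderivx ix0) yx mulr0 addr0.
have UyE : U^`M(iy) = evx 'X_iy R^`().
  by rewrite UE (evx_mderivN ix0) // yy mulr1.
have inj := evx_inj ix0 char0 iyx (_ : ('X_iy : {mpoly k[n]})^`M(iy) != 0).
have {}inj : injective (evx ('X_iy : {mpoly k[n]})) by apply: inj; rewrite yy oner_eq0.
have sR : (1 < size R)%N.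
  rewrite ltnNge; apply: contraNN U_y0 => sR; rewrite UyE.
  have -> : R^`() = 0.
    apply/size_poly_leq0P; rewrite (size_deriv0 (pchar0_poly char0)).
    by case: size sR => [|[]].
  by rewrite rmorph0.
have WR : dx R^`() * R^`() = dx R * R^`()^`().
  apply: inj; move: wr; rewrite UyE UxE (evx_mderivx ix0) (evx_mderivN ix0) // yy yx.
  by rewrite mulr1 mulr0 addr0 !rmorphM /= [RHS]mulrC => ->; rewrite mulrC.
have [b [P [[sP _] RE]]] := normal_form char0 sR WR.
exists P, ((((size R).-1)%:R * lead_coef P)^-1 *: b); split.
- by rewrite sP prednK // ltnW.
- by rewrite UE {1}RE evx_comp -[2%N]/(iy.+1) xvarE.
- by rewrite UxE UyE {1}RE dx_polyC_comp -RE rmorphM /= evxC mulrC.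
Qed.

Lemma component_shape i (C R : {poly {poly k}}) : (2 <= i < r)%N -> C`_0 = 0 ->
  u i = evx U C + evx 'X_(iz i) R ->
  (exists b P : {poly k}, nice_of_degree (d i) P /\
     evx 'X_(iz i) R = shifted n i (d i) b P)
  /\ ((2 <= d i)%N -> dx C = 0).
Proof.
move=> ir C0 uE; have [zE zx zy z2] := iz_facts ir.
have uz := s_neq0 ir; have Uz := U_free z2.
have sR := size_shape char0 ix0 zx Uz uE uz.
have dE : d i = (size R).-1.
  rewrite d_def ?pred_r // -{1}zE; exact: (degx_shape char0 ix0 zx Uz uE uz).
have i_n : (i < n)%N by case/andP: ir => _ /leq_trans; apply.
have eq_i : (u i)^`M(iz i) * (u i.+1)^`M(iy)
    = U^`M(ix) * (u i)^`M(iy) - U^`M(iy) * (u i)^`M(ix).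
  by rewrite -pderiv_iz // (sys.2 i) //; case/andP: ir => -> /ltnW ->.
have wz : (u i.+1)^`M(iy)^`M(iz i) = 0.
  by apply: w_free => //; case/andP: ir => /ltnW i2 ->; rewrite ltnS i2.
split; last first.
  rewrite dE => d2; apply: (dxC_shape char0 ix0 iyx zx zy U_y0 Uz uE C0 wz eq_i).
  by move: d2; case: (size R) => [|[]].
have W := wronskian_shape char0 ix0 iyx zx zy U_y0 Uz uE C0 wz eq_i.
have [b [P [nP RE]]] := normal_form char0 sR W.
by exists b, P; rewrite dE shifted_iz // /shifted_poly -RE.
Qed.

Lemma next_component_y i (C : {poly {poly k}}) (b P : {poly k}) :
  (2 <= i < r)%N -> C`_0 = 0 -> nice_of_degree (d i) P ->
  u i = evx U C + shifted n i (d i) b P ->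
  ((2 <= d i)%N -> dx C = 0) /\
  (u i.+1)^`M(iy) =
    - ((d i)%:R * lead_coef P)^-1 *: ((evx U (dx C) + inx n b^`()) * U^`M(iy)).
Proof.
move=> ir C0 nP uE; have dC : (2 <= d i)%N -> dx C = 0.
  by have := uE; rewrite shifted_iz // => /(component_shape ir C0) [].
split=> //; apply/(step_equation_iz ir nP dC uE); apply: sys.2.
by case/andP: ir => -> /ltnW ->.
Qed.

(** What is left of the next component after removing its part that is polynomial
    in the first one is free of y by [step_equation], and does not depend on its
    new variable either if this component is the [r]-th one. *)
Lemma next_component_free i l c (b P : {poly k})
    (N := next_part ((d i)%:R * lead_coef P)^-1 l c b) (j : 'I_n) :
  (2 <= i < r)%N -> nice_of_degree (d i) P ->
  u i = evx U (poly_part l c) + shifted n i (d i) b P ->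
  j != ix -> (j = i.+1 :> nat -> i.+1 = r) ->
  (u i.+1 - evx U N)^`M(j) = 0.
Proof.
move=> ir nP uE jx jr; rewrite mderivB.
have C0 : (poly_part l c)`_0 = 0 by rewrite coef_poly_part.
have [_ wE] := next_component_y ir C0 nP uE.
have [->|jy] := eqVneq j iy.
  rewrite wE (evx_mderivN ix0) // deriv_next_part // rmorphM /= evxC (inxC ix0).
  by rewrite rmorphD /= evxC mul_mpolyC -scalerAl subrr.
have j2 : (2 <= j)%N by case: j jx jy {jr} => -[|[|j]].
rewrite evxU_free // subr0; have [ji|ji] := eqVneq (nat_of_ord j) i.+1.
  by rewrite jr // ur_free.
by apply: u_free => //; case/andP: ir => i2 ri; rewrite ltnW ?ltnS // (leq_trans ri).
Qed.

Lemma poly_part_const l (c : nat -> {poly k}) : dx (poly_part l c) = 0 ->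
  forall j : nat, (1 <= j <= l)%N -> (c j)^`() = 0.
Proof.
move=> C'0 j jl; have := congr1 (fun q : {poly {poly k}} => q`_j) C'0.
by rewrite coef_dx coef_poly_part jl coef0.
Qed.

Lemma second_component (a : {poly k}) : U^`M(ix) = inx n a^`() * U^`M(iy) ->
  exists b P : {poly k}, [/\ nice_of_degree (d 2) P,
    u 2 = - inx n a^`() * U + shifted n 2 (d 2) b P &
    (2 <= d 2)%N -> a^`()^`() = 0].
Proof.
move=> Ux; pose C : {poly {poly k}} := - (a^`())%:P * 'X.
have r2 : (2 <= 2 < r)%N by [].
have [zE zx zy z2] := iz_facts r2.
have evC : evx U C = - inx n a^`() * U.
  by rewrite /C -polyCN rmorphM /= evxC evxX rmorphN.
have [R RE] : exists R, u 2 - evx U C = evx 'X_(iz 2) R.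
  apply: (evx_of_mderiv ix0 char0 zx) => j jx jz; rewrite mderivB.
  have [->|jy] := eqVneq j iy.
    rewrite evC mderivM mderivN (inx_mderivN ix0) // oppr0 mul0r add0r.
    by rewrite mulNr opprK -Ux addrC sys.1.
  have j2 : (2 <= j)%N by case: j jx jy {jz} => -[|[|j]].
  rewrite evxU_free // subr0; apply: u_free; rewrite ?(ltnW n_ge3) //.
  by apply: contraNneq jz => jE; apply/eqP/val_inj; rewrite /= zE jE.
have uE : u 2 = evx U C + evx 'X_(iz 2) R by rewrite -RE addrC subrK.
have C0 : C`_0 = 0 by rewrite coefMX.
have [[b [P [nP shE]]] dC] := component_shape r2 C0 uE.
exists b, P; split=> //; first by rewrite uE evC shE.
move=> /dC; rewrite /C -polyCN (dx_derivation k).2 dxX mulr0 addr0 dxC.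
move=> /(congr1 (fun q : {poly {poly k}} => q`_1)).
by rewrite coefMX coefC coef0 /= derivN => /eqP; rewrite oppr_eq0 => /eqP.
Qed.

Section NextComponent.
Variables (i l : nat) (c : nat -> {poly k}) (b P : {poly k}).
Hypothesis ir : (2 <= i < r)%N.
Hypothesis nP : nice_of_degree (d i) P.
Hypothesis uE : u i = \sum_(1 <= j < l.+1) inx n (c j) * U ^+ j + shifted n i (d i) b P.

Let kappa := ((d i)%:R * lead_coef P)^-1.
Let N := next_part kappa l c b.
Let uE' : u i = evx U (poly_part l c) + shifted n i (d i) b P.
Proof. by rewrite evx_poly_part. Qed.

Lemma next_component_const : (2 <= d i)%N ->
  forall j : nat, (1 <= j <= l)%N -> (c j)^`() = 0.
Proof.
move=> d2; apply: poly_part_const.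
by have [|dC _] := next_component_y ir _ nP uE'; [rewrite coef_poly_part | apply: dC].
Qed.

Lemma next_component : (i.+1 < r)%N -> exists bi Pi : {poly k},
  nice_of_degree (d i.+1) Pi /\
  u i.+1 = - kappa *: (\sum_(1 <= j < l.+1)
      j.+1%:R^-1 *: (inx n (c j)^`() * U ^+ j.+1) + inx n b^`() * U)
    + shifted n i.+1 (d i.+1) bi Pi.
Proof.
move=> ir1; have ir' : (2 <= i.+1 < r)%N by rewrite ir1 andbT; case/andP: ir => /ltnW.
have [zE zx zy z2] := iz_facts ir'.
have [R RE] : exists R, u i.+1 - evx U N = evx 'X_(iz i.+1) R.
  apply: (evx_of_mderiv ix0 char0 zx) => j jx jz.
  apply: (next_component_free ir nP uE' jx) => jE.
  by case/eqP: jz; apply: val_inj; rewrite /= zE.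
have uE1 : u i.+1 = evx U N + evx 'X_(iz i.+1) R by rewrite -RE addrC subrK.
have N0 : N`_0 = 0 by rewrite coef_next_part.
have [[bi [Pi [nPi shE]]] _] := component_shape ir' N0 uE1.
by exists bi, Pi; rewrite uE1 shE /N (evx_next_part ix0).
Qed.

(** The equation of the [r]-th component says that [N] plus [rho], a polynomial
    in the first component over k[x], is killed by the derivative in x of its
    coefficients. *)
Lemma last_component : i.+1 = r ->
  [/\ exists br : k, u r = - kappa *: (\sum_(1 <= j < l.+1)
          j.+1%:R^-1 *: (inx n (c j)^`() * U ^+ j.+1) + inx n b^`() * U) + br%:MP,
      forall j : nat, (1 <= j <= l)%N -> exists e : k, (c j)^`() = e%:P &
      exists e : k, b^`() = e%:P].
Proof.
move=> ir1; have [rho rhoE] : exists rho, u r - evx U N = inx n rho.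
  apply: (inx_of_mderiv ix0 char0) => j jx; rewrite -ir1.
  exact: (next_component_free ir nP uE' jx).
have urE : u r = evx U N + inx n rho by rewrite -rhoE addrC subrK.
have const : dx N + rho^`()%:P = 0.
  apply: (evx_inj ix0 char0 iyx U_y0); apply: (mulfI U_y0).
  have rr : (2 <= r <= r)%N by rewrite leqnn andbT ltnW.
  have := sys.2 r rr; rewrite r_stop mul0r urE !mderivD (evx_mderivx ix0).
  rewrite (evx_mderivN ix0) // (inx_mderivx ix0) (inx_mderivN ix0) // => e.
  rewrite rmorph0 mulr0 rmorphD /= evxC -oppr0 e.
  by ring.
have kappa0 : kappa != 0 by rewrite invr_eq0 (nice_lead_neq0 char0 nP).
have coefN j : (dx N)`_j.+1 = 0.
  have := congr1 (fun q : {poly {poly k}} => q`_j.+1) const.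
  by rewrite coefD coefC addr0 coef0.
split.
- have := congr1 (fun q : {poly {poly k}} => q`_0) const.
  rewrite coefD coef_dx coef_next_part deriv0 add0r coefC coef0 /=.
  move=> /(deriv_eq0 char0) rhoC; exists rho`_0.
  by rewrite urE {1}rhoC (inxC ix0) /N (evx_next_part ix0).
- move=> j jl; exists ((c j)^`())`_0; apply: (deriv_eq0 char0).
  have /eqP := coefN j; rewrite coef_dx coef_next_part jl !derivZ !scaler_eq0.
  by rewrite oppr_eq0 (negbTE kappa0) invr_eq0 (negbTE (natr_neq0 char0 _)) //= => /eqP.
- exists (b^`())`_0; apply: (deriv_eq0 char0).
  have /eqP := coefN 0%N; rewrite coef_dx coef_next_part /= derivZ scaler_eq0.
  by rewrite oppr_eq0 (negbTE kappa0) => /eqP.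
Qed.

End NextComponent.

End Necessity.

(** * Sufficiency *)

Section Sufficiency.

Lemma step_equation_next i l (c : nat -> {poly k}) (b P : {poly k}) rest :
  (2 <= i < r)%N -> nice_of_degree (d i) P ->
  u i = \sum_(1 <= j < l.+1) inx n (c j) * U ^+ j + shifted n i (d i) b P ->
  ((2 <= d i)%N -> forall j : nat, (1 <= j <= l)%N -> (c j)^`() = 0) ->
  u i.+1 = - ((d i)%:R * lead_coef P)^-1 *: (\sum_(1 <= j < l.+1)
      j.+1%:R^-1 *: (inx n (c j)^`() * U ^+ j.+1) + inx n b^`() * U) + rest ->
  rest^`M(iy) = 0 ->
  pderiv i.+1 (u i) * (u i.+1)^`M(iy)
    = U^`M(ix) * (u i)^`M(iy) - U^`M(iy) * (u i)^`M(ix).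
Proof.
move=> ir nP uE dc uE1 rest_y; rewrite -evx_poly_part in uE.
apply/(step_equation_iz ir nP _ uE) => [d2|].
  rewrite dx_poly_part; apply/polyP => j; rewrite coef_poly_part coef0.
  by case: ifP => // jl; rewrite dc.
rewrite uE1 -(evx_next_part ix0) mderivD rest_y addr0 (evx_mderivN ix0) //.
rewrite deriv_next_part // rmorphM /= evxC (inxC ix0) rmorphD /= evxC.
by rewrite mul_mpolyC -scalerAl.
Qed.

Lemma shifted_free_y i m (b P : {poly k}) : (2 <= i < r)%N ->
  (shifted n i m b P)^`M(iy) = 0.
Proof.
move=> ir; have [_ _ zy _] := iz_facts ir.
by rewrite shifted_iz // (evx_mderivN ix0) // mderivXU (negbTE zy) mulr0.
Qed.

Hypothesis cond_b : forall i l (c : nat -> {poly k}) (b P : {poly k}),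
  (2 <= i)%N -> (i.+1 < r)%N -> nice_of_degree (d i) P ->
  u i = \sum_(1 <= j < l.+1) inx n (c j) * U ^+ j + shifted n i (d i) b P ->
  (exists bi Pi : {poly k}, nice_of_degree (d i.+1) Pi /\
     u i.+1 = - ((d i)%:R * lead_coef P)^-1 *: (\sum_(1 <= j < l.+1)
         j.+1%:R^-1 *: (inx n (c j)^`() * U ^+ j.+1) + inx n b^`() * U)
       + shifted n i.+1 (d i.+1) bi Pi) /\
  ((2 <= d i)%N -> forall j : nat, (1 <= j <= l)%N -> (c j)^`() = 0).

Hypothesis cond_c : forall i l (c : nat -> {poly k}) (b P : {poly k}),
  i.+1 = r -> nice_of_degree (d i) P ->
  u i = \sum_(1 <= j < l.+1) inx n (c j) * U ^+ j + shifted n i (d i) b P ->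
  [/\ exists br : k, u r = - ((d i)%:R * lead_coef P)^-1 *:
        (\sum_(1 <= j < l.+1) j.+1%:R^-1 *: (inx n (c j)^`() * U ^+ j.+1)
         + inx n b^`() * U) + br%:MP,
      forall j : nat, (1 <= j <= l)%N -> exists e : k, (c j)^`() = e%:P,
      exists e : k, b^`() = e%:P &
      (2 <= d i)%N -> forall j : nat, (1 <= j <= l)%N -> (c j)^`() = 0].

Variables (p a b2 P2 : {poly k}).
Hypothesis P2_nice : nice_of_degree (d 2) P2.
Hypothesis UE : U = horner_alg (xvar k n 2 + inx n a) p.
Hypothesis u2E : u 2 = - inx n a^`() * U + shifted n 2 (d 2) b2 P2.

(** By [cond_b], the shape of the second component propagates to the others. *)
Lemma component_form i : (2 <= i < r)%N ->
  exists l (c : nat -> {poly k}) (b P : {poly k}), nice_of_degree (d i) P /\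
    u i = \sum_(1 <= j < l.+1) inx n (c j) * U ^+ j + shifted n i (d i) b P.
Proof.
elim: i => [|i IHi] // /andP [i2 ir]; have [i1|i1] := eqVneq i 1%N.
  exists 1%N, (fun=> - a^`()), b2, P2; rewrite i1; split=> //.
  by rewrite big_nat1 expr1 rmorphN.
have {}i2 : (2 <= i)%N by rewrite ltn_neqAle eq_sym i1.
have ir' : (2 <= i < r)%N by rewrite i2 ltnW.
have [l [c [b [P [nP uE]]]]] := IHi ir'.
have [[bi [Pi [nPi uE1]]] _] := cond_b i2 ir nP uE.
pose N := next_part ((d i)%:R * lead_coef P)^-1 l c b.
exists l.+1, (fun j => N`_j), bi, Pi; split=> //.
rewrite {1}uE1 -(evx_next_part ix0) -evx_poly_part; congr (evx U _ + _).
apply/polyP => j; rewrite coef_poly_part; case: j => [|j]; rewrite coef_next_part //=.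
rewrite ltnS; case jl: (j <= l)%N => //; rewrite andbF.
by case: (j) jl => // *; rewrite scaler0.
Qed.

Lemma sufficiency : jacobian_system.
Proof.
have Ux : U^`M(ix) = inx n a^`() * U^`M(iy).
  have yx : ('X_iy : {mpoly k[n]})^`M(ix) = 0 by rewrite mderivXU.
  have yy : ('X_iy : {mpoly k[n]})^`M(iy) = 1 by rewrite mderivXU.
  have UE' : U = evx 'X_iy (map_poly polyC p \Po ('X + a%:P)).
    by rewrite UE evx_comp -[2%N]/(iy.+1) xvarE.
  rewrite UE' (evx_mderivx ix0) (evx_mderivN ix0) // yx yy mulr0 addr0 mulr1.
  by rewrite dx_polyC_comp rmorphM /= evxC mulrC.
split.
  rewrite u2E mderivD shifted_free_y // addr0 mderivM mderivN (inx_mderivN ix0) //.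
  by rewrite oppr0 mul0r add0r mulNr -Ux subrr.
move=> i /andP [i2]; rewrite leq_eqVlt => /orP [/eqP ->|ir].
  have r1 : r.-1.+1 = r by rewrite prednK // ltnW // ltnW.
  have ir : (2 <= r.-1 < r)%N by rewrite -ltnS r1 r3 leqnn.
  have [l [c [b [P [nP uE]]]]] := component_form ir.
  have [[br urE] cC [eb bC] _] := cond_c r1 nP uE.
  rewrite r_stop mul0r urE -(evx_next_part ix0); set N := next_part _ _ _ _.
  have dxN : dx N = 0.
    apply/polyP => j; rewrite coef_dx coef0 coef_next_part.
    case: j => [|j]; first by rewrite deriv0.
    rewrite derivZ; case: ifP => [jl|_].
      by have [e ->] := cC j jl; rewrite derivZ derivC !scaler0.
    by case: eqP; rewrite ?bC ?derivC ?deriv0 scaler0.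
  rewrite !mderivD !mderivC !addr0 (evx_mderivx ix0) (evx_mderivN ix0) // dxN.
  by rewrite rmorph0; ring.
have ir' : (2 <= i < r)%N by rewrite i2.
have [l [c [b [P [nP uE]]]]] := component_form ir'.
have [ir1|ir1] := eqVneq i.+1 r.
  have [[br urE] _ _ dc] := cond_c ir1 nP uE.
  by rewrite -ir1 in urE; apply: (step_equation_next ir' nP uE dc urE); rewrite mderivC.
have {}ir1 : (i.+1 < r)%N by rewrite ltn_neqAle ir1.
have [[bi [Pi [nPi uE1]]] dc] := cond_b i2 ir1 nP uE.
apply: (step_equation_next ir' nP uE dc uE1); apply: shifted_free_y.
by rewrite ir1 ltnW.
Qed.

End Sufficiency.

End Map.

Theorem theorem1 (k : fieldType) (char0 : [pchar k] =i pred0)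
  (n : nat) (n_ge3 : (3 <= n)%N)
  (u : nat -> {mpoly k[n]})
  (u1_vars : in_vars [:: 1; 2]%N (u 1%N))
  (ui_vars : forall i : nat, (2 <= i <= n.-1)%N ->
     in_vars [:: 1; 2; i.+1]%N (u i))
  (un_vars : in_vars [:: 1; 2]%N (u n))
  (u2_x3 : pderiv 3 (u 2%N) <> 0)
  (u_y : pderiv 2 (u 1%N) <> 0)
  (r : nat) (r_bounds : (3 <= r <= n)%N)
  (r_below : forall i : nat, (2 <= i <= r.-1)%N -> pderiv i.+1 (u i) <> 0)
  (r_stop : pderiv r.+1 (u r) = 0)
  (d : nat -> nat)
  (d_def : forall i : nat, (2 <= i <= r.-1)%N -> d i = degx i.+1 (u i)) :
  nilpotent_mx (jacobian u) <->
  [/\ (* (a) *)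
      exists p a b2 P2 : {poly k},
        [/\ (1 < size p)%N,
            nice_of_degree (d 2%N) P2,
            u 1%N = horner_alg (xvar k n 2 + inx n a) p,
            u 2%N = - inx n (a^`()) * u 1%N + shifted n 2 (d 2%N) b2 P2
          & (2 <= d 2%N)%N -> a^`()^`() = 0],
      (* (b) *)
      forall i : nat, (3 <= i <= r.-1)%N ->
        forall (l : nat) (c : nat -> {poly k}) (b P : {poly k}),
          nice_of_degree (d i.-1) P ->
          u i.-1 = \sum_(1 <= j < l.+1) inx n (c j) * u 1%N ^+ j
                   + shifted n i.-1 (d i.-1) b P ->
          (exists bi Pi : {poly k},
             nice_of_degree (d i) Pi /\
             u i = - ((d i.-1)%:R * lead_coef P)^-1 *:
                     (\sum_(1 <= j < l.+1)
                         (j.+1%:R)^-1 *: (inx n ((c j)^`()) * u 1%N ^+ j.+1)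
                      + inx n (b^`()) * u 1%N)
                   + shifted n i (d i) bi Pi) /\
          ((2 <= d i.-1)%N -> forall j : nat, (1 <= j <= l)%N -> (c j)^`() = 0)
    & (* (c) *)
      forall (l : nat) (c : nat -> {poly k}) (b P : {poly k}),
        nice_of_degree (d r.-1) P ->
        u r.-1 = \sum_(1 <= j < l.+1) inx n (c j) * u 1%N ^+ j
                 + shifted n r.-1 (d r.-1) b P ->
        [/\ exists br : k,
              u r = - ((d r.-1)%:R * lead_coef P)^-1 *:
                      (\sum_(1 <= j < l.+1)
                          (j.+1%:R)^-1 *: (inx n ((c j)^`()) * u 1%N ^+ j.+1)
                       + inx n (b^`()) * u 1%N)
                    + br%:MP,
            forall j : nat, (1 <= j <= l)%N -> exists e : k, (c j)^`() = e%:P,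
            exists e : k, b^`() = e%:P
          & (2 <= d r.-1)%N ->
            forall j : nat, (1 <= j <= l)%N -> (c j)^`() = 0]].
Proof.
have r3 : (3 <= r)%N by case/andP: r_bounds.
have r1 : r.-1.+1 = r by rewrite prednK // ltnW // ltnW.
have nilE := nilpotent_jacobian n_ge3 u1_vars ui_vars un_vars u_y r_bounds
  r_below r_stop.
split=> [/nilE sys|[[p [a [b2 [P2 [_ nP2 UE u2E _]]]]] cond_b cond_c]].
- split.
  + have [p [a [sp UE Ux]]] := first_component char0 u1_vars ui_vars un_vars u_y
      r_bounds r_below r_stop sys.
    have [b2 [P2 [nP2 u2E a2]]] := second_component char0 u1_vars ui_vars un_vars u_y
      r_bounds r_below d_def sys Ux.
    by exists p, a, b2, P2.
  + move=> [|i] // /andP [i2 ir] l c b P nP uE.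
    rewrite -ltnS r1 in ir; rewrite ltnS in i2.
    have ir' : (2 <= i < r)%N by rewrite i2 ltnW.
    split; last exact: (next_component_const char0 u1_vars ui_vars un_vars u_y
      r_bounds r_below d_def sys ir' nP uE).
    exact: (next_component char0 u1_vars ui_vars un_vars u_y
      r_bounds r_below r_stop d_def sys ir' nP uE ir).
  + move=> l c b P nP uE.
    have ir : (2 <= r.-1 < r)%N by rewrite -ltnS r1 r3 leqnn.
    have [urE cC bC] := last_component char0 u1_vars ui_vars un_vars u_y
      r_bounds r_below r_stop d_def sys ir nP uE r1.
    split=> //; exact: (next_component_const char0 u1_vars ui_vars un_vars u_y
      r_bounds r_below d_def sys ir nP uE).
- apply/nilE; apply: (sufficiency char0 n_ge3 u1_vars r_bounds r_stop _ _ nP2 UE u2E).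
  + move=> i l c b P i2 ir nP uE; apply: (cond_b i.+1) => //.
    by rewrite ltnS i2 -ltnS r1.
  + move=> i l c b P ir nP uE; have iE : r.-1 = i by rewrite -ir.
    by move: cond_c; rewrite iE => /(_ l c b P nP uE).
Qed.
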